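(* For $\alpha\in[0,1)$, the sharp $\mathcal{S}^*_{\mathfrak{B}}$-radius for $\mathcal{S}^*(\alpha)$ is $$\frac{\sqrt{2}\,e-\sqrt{1+e^2}}{(1-2\alpha)\sqrt{1+e^2}+\sqrt{2}\,e}.$$ In particular, $R_{\mathcal{S}^*_{\mathfrak{B}}}(\mathcal{S}^* )=\frac{\sqrt{2}\,e-\sqrt{1+e^2}}{\sqrt{2}\,e+\sqrt{1+e^2}}\simeq0.1406$. The bound is sharp for $k_\alpha(z)=z/(1-z)^{2(1-\alpha)}$.
   Context: $\mathbb{D}$ is the open unit disk. $\mathcal{A}$ is the class of analytic functions $f$ in $\mathbb{D}$ with $f(z)=z+\sum_{n\ge2}a_nz^n$, and $\mathcal{S}\subset\mathcal{A}$ is the subclass of univalent functions. $f\prec g$ (subordination) means $f=g\circ w$ for some analytic $w:\mathbb{D}\to\mathbb{D}$ with $w(0)=0$. $\mathfrak{B}(z)=\sqrt{1+\tanh z}$ (principal branch), and $\mathcal{S}^*_{\mathfrak{B}}=\{f\in\mathcal{S}: zf'(z)/f(z)\prec\mathfrak{B}(z)\}$. $\mathcal{S}^*(\alpha)=\{f\in\mathcal{S}: zf'(z)/f(z)\prec(1+(1-2\alpha)z)/(1-z)\}$, and $\mathcal{S}^*=\mathcal{S}^*(0)$ is the class of starlike functions. For a class $\mathcal{G}\subset\mathcal{A}$, the (sharp) $\mathcal{S}^*_{\mathfrak{B}}$-radius $R_{\mathcal{S}^*_{\mathfrak{B}}}(\mathcal{G})$ is the largest $R\in(0,1]$ such that for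 every $f\in\mathcal{G}$ and every $0<r\le R$ the function $z\mapsto f(rz)/r$ belongs to $\mathcal{S}^*_{\mathfrak{B}}$. The bound being sharp for $k_\alpha$ means that for $f=k_\alpha$ the radius cannot be enlarged. *)

(* Defs.v *)
From Stdlib Require Import Reals.
From Coquelicot Require Import Coquelicot.

Local Open Scope R_scope.
Local Open Scope C_scope.

Definition Cexp (z : C) : C :=
  (exp (Re z) * cos (Im z), exp (Re z) * sin (Im z))%R.

Definition Ctanh (z : C) : C :=
  (Cexp z - Cexp (- z)) / (Cexp z + Cexp (- z)).

(** Principal argument, with values in (-PI, PI]; only meaningful for [z <> 0]. *)
Definition Carg (z : C) : R :=
  if Rle_dec 0 (Im z) then acos (Re z / Cmod z) else (- acos (Re z / Cmod z))%R.

Definition Cln (z : C) : C := (ln (Cmod z), Carg z).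

(** Principal branch; the power is only meaningful for [z <> 0]. *)
Definition Cpower (z s : C) : C := Cexp (s * Cln z).

(** Principal branch: [|z|^(1/2) e^(i Arg(z)/2)], which is [0] at [z = 0]. *)
Definition Csqrt (z : C) : C := RtoC (sqrt (Cmod z)) * Cexp (Ci * RtoC (Carg z / 2)).

Definition disk (z : C) : Prop := (Cmod z < 1)%R.

(** Functions on the unit disk are represented by total functions [C -> C] of
    which only the values on [disk] matter. Analytic means complex
    differentiable at every point of the (open) disk. *)
Definition analytic (f : C -> C) : Prop :=
  forall z : C, disk z -> ex_derive (K := C_AbsRing) (V := C_NormedModule) f z.

Definition classA (f : C -> C) : Prop :=
  analytic f /\
  exists a : nat -> C, forall z : C, disk z ->
    is_series (K := C_AbsRing) (V := C_NormedModule)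
      (fun n : nat => a (n + 2)%nat * z ^ (n + 2)) (f z - z).

Definition univalent (f : C -> C) : Prop :=
  forall z1 z2 : C, disk z1 -> disk z2 -> f z1 = f z2 -> z1 = z2.

Definition classS (f : C -> C) : Prop := classA f /\ univalent f.

Definition subordinate (f g : C -> C) : Prop :=
  exists w : C -> C,
    analytic w /\ (forall z : C, disk z -> disk (w z)) /\ w 0 = 0 /\
    forall z : C, disk z -> f z = g (w z).

(** [z f'(z) / f(z)]. For [f] in [classS] it has a removable singularity at
    [0], where its value is [1]; elsewhere in the disk [f z <> 0]. *)
Definition zlogder (f : C -> C) (z : C) : C :=
  if Ceq_dec z 0 then 1 else z * C_derive f z / f z.

Definition frakB (z : C) : C := Csqrt (1 + Ctanh z).

Definition SB (f : C -> C) : Prop := classS f /\ subordinate (zlogder f) frakB.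

Definition starlike_order (alpha : R) (f : C -> C) : Prop :=
  classS f /\
  subordinate (zlogder f) (fun z : C => (1 + RtoC (1 - 2 * alpha) * z) / (1 - z)).

Definition starlike : (C -> C) -> Prop := starlike_order 0.

Definition dilation (r : R) (f : C -> C) (z : C) : C := f (r * z) / r.

Definition admissible_radius (F G : (C -> C) -> Prop) (rho : R) : Prop :=
  (0 < rho <= 1)%R /\
  forall f : C -> C, G f ->
    forall r : R, (0 < r <= rho)%R -> F (dilation r f).

(** [rho] is the [F]-radius of the class [G]: the largest admissible radius. *)
Definition is_radius (F G : (C -> C) -> Prop) (rho : R) : Prop :=
  admissible_radius F G rho /\
  forall rho' : R, admissible_radius F G rho' -> (rho' <= rho)%R.

Definition k_ (alpha : R) (z : C) : C := z / Cpower (1 - z) (RtoC (2 * (1 - alpha))).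

(* Main.v *)
Require Import Defs.
From Stdlib Require Import Reals Lra Psatz Lia.
From Coquelicot Require Import Coquelicot.

(** The image of the disk under [frakB] contains the disk [|v - 1| < delta], where
    [delta = frakB 1 - 1]: the solution of [frakB (Blog t) = 1 + t] is
    [Blog t = ln (1 + t) - ln (1 - 2 t - t^2) / 2], whose derivative
    [2 / (1 - t - 3 t^2 - t^3)] has nonnegative Taylor coefficients, so that
    [|Blog t| <= Blog |t| < Blog delta = 1]. If [z f'/f = p (w z)] with
    [p u = (1 + (1 - 2 alpha) u) / (1 - u)], then [|w z| <= |z|] by the Schwarz lemma, and
    [|p u - 1| <= p |u| - 1 < delta] as soon as [|u|] is less than the root [rho] of
    [p rho = frakB 1]. Conversely, for [k_alpha] the value [p x] with [x] slightly
    larger than [rho] is real and larger than [frakB 1], and [frakB v = p x] forces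
    [Re v > 1]. *)

Local Open Scope R_scope.

(** * Complex derivatives *)

(** Since 1 + tanh w = 2 e^(2w) / (e^(2w) + 1), the equation [frakB w = v] leads to e^(2w) = v^2 /
    (2 - v^2). With v = 1 + t the denominator is 1 - 2t - t^2, and half the logarithm is [Blog t].
    The constants come from frakB 1 = sqrt (2 e^2 / (1 + e^2)). Read in moduli, the same equation
    drives sharpness: e^(2 Re v) = q^2 / (2 - q^2) increases with q up to q = sqrt 2, so q > frakB 1
    needs Re v > 1.

    The Schwarz lemma is the obstacle: [analytic] is bare differentiability, while the integral
    argument behind the maximum modulus wants a continuous derivative. The Taylor series in [classA]
    supplies it: f and f' are given by power series, so the Schwarz function w, solved for
    algebraically, is C1.

    That [k_ alpha] lies in [classS] is a second task. Its Taylor series comes from the differential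
    equation of the binomial series, its univalence from passing to log z, where it becomes a map of
    a half plane whose derivative has positive real part. *)

Definition cderiv (f : C -> C) (z l : C) : Prop :=
  is_derive (K := C_AbsRing) (V := C_NormedModule) f z l.

Lemma cderiv_eps (f : C -> C) (z l : C) :
  cderiv f z l <->
  forall eps, 0 < eps -> exists d, 0 < d /\ forall h, Cmod h < d ->
    Cmod (f (z + h) - f z - h * l)%C <= eps * Cmod h.
Proof.
  split.
  - intros [_ H] eps Heps.
    destruct (H z (fun P HP => HP) (mkposreal eps Heps)) as [d Hd].
    exists d; split; [apply cond_pos|]. intros h Hh.
    assert (Hb : ball (M := AbsRing_UniformSpace C_AbsRing) z d (z + h)%C).
    { change (Cmod (z + h + - z)%C < d). replace (z + h + - z)%C with h by ring. exact Hh. }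
    specialize (Hd _ Hb).
    change (Cmod ((f (z + h)%C + - f z) + - ((z + h + - z) * l))%C
      <= eps * Cmod (z + h + - z)%C) in Hd.
    replace (z + h + - z)%C with h in Hd by ring. exact Hd.
  - intros H; split; [apply is_linear_scal_l|].
    intros x Hx eps.
    apply (is_filter_lim_locally_unique (K := C_AbsRing) (V := AbsRing_NormedModule C_AbsRing)) in Hx.
    subst x.
    destruct (H eps (cond_pos eps)) as [d [Hd0 Hd]].
    exists (mkposreal d Hd0). intros y Hy. change C in y.
    change (Cmod (y + - z)%C < d) in Hy.
    specialize (Hd _ Hy).
    replace (z + (y + - z))%C with y in Hd by ring.
    exact Hd.
Qed.

Lemma Rabs_Re_le (z : C) : Rabs (fst z) <= Cmod z.
Proof. eapply Rle_trans; [apply Rmax_l | apply Rmax_Cmod]. Qed.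

Lemma Rabs_Im_le (z : C) : Rabs (snd z) <= Cmod z.
Proof. eapply Rle_trans; [apply Rmax_r | apply Rmax_Cmod]. Qed.

Lemma Re_le_Cmod (z : C) : Re z <= Cmod z.
Proof. eapply Rle_trans; [apply Rle_abs | apply Rabs_Re_le]. Qed.

Lemma Cmod_le_sum (z : C) : Cmod z <= Rabs (fst z) + Rabs (snd z).
Proof.
  unfold Cmod. apply Rsqr_incr_0_var; [|apply Rplus_le_le_0_compat; apply Rabs_pos].
  rewrite Rsqr_sqrt by nra. unfold Rsqr.
  rewrite <- (pow2_abs (fst z)), <- (pow2_abs (snd z)).
  assert (H1 := Rabs_pos (fst z)). assert (H2 := Rabs_pos (snd z)). nra.
Qed.

(** The Cauchy-Riemann equations. Through them [Cexp] and [Cln] are differentiated by real partial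
    derivatives, and curves by the real two-variable chain rule. Passing between [Rmax] of the
    coordinates and [Cmod] costs a factor 2, hence the [eps / 2] in both directions. *)
Lemma cderiv_CR (f : C -> C) (x y : R) (l : C) :
  cderiv f (x, y) l <->
  differentiable_pt_lim (fun u v => Re (f (u, v))) x y (Re l) (- Im l) /\
  differentiable_pt_lim (fun u v => Im (f (u, v))) x y (Im l) (Re l).
Proof.
  rewrite cderiv_eps. split.
  - intros H.
    assert (K : forall eps : posreal, locally_2d (fun u v =>
      Cmod (f (u, v) - f (x, y) - ((u - x)%R, (v - y)%R) * l)%C <=
        eps * Rmax (Rabs (u - x)) (Rabs (v - y))) x y).
    { intros eps.
      destruct (H (eps / 2)) as [d [Hd0 Hd]]; [apply is_pos_div_2|].
      assert (Hd2 : 0 < d / 2) by lra.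
      exists (mkposreal _ Hd2). simpl. intros u v Hu Hv.
      assert (Hm : Cmod (u - x, v - y) <= 2 * Rmax (Rabs (u - x)) (Rabs (v - y))).
      { eapply Rle_trans; [apply Cmod_le_sum|]. simpl.
        assert (A := Rmax_l (Rabs (u - x)) (Rabs (v - y))).
        assert (B := Rmax_r (Rabs (u - x)) (Rabs (v - y))). lra. }
      assert (Hm2 : Cmod (u - x, v - y) < d).
      { eapply Rle_lt_trans; [apply Cmod_le_sum|]. simpl. lra. }
      specialize (Hd _ Hm2).
      replace ((x, y) + ((u - x)%R, (v - y)%R))%C with (u, v) in Hd
        by (apply injective_projections; simpl; ring).
      assert (He := cond_pos eps). nra. }
    split; intros eps; destruct (K eps) as [d Hd]; exists d; intros u v Hu Hv;
      (eapply Rle_trans; [|apply (Hd u v Hu Hv)]).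
    + eapply Rle_trans; [|apply Rabs_Re_le]. right. f_equal. unfold Re, Im; simpl. ring.
    + eapply Rle_trans; [|apply Rabs_Im_le]. right. f_equal. unfold Re, Im; simpl. ring.
  - intros [H1 H2] eps Heps.
    assert (He2 : 0 < eps / 2) by lra.
    destruct (H1 (mkposreal _ He2)) as [d1 Hd1].
    destruct (H2 (mkposreal _ He2)) as [d2 Hd2].
    exists (Rmin d1 d2). split; [apply Rmin_pos; apply cond_pos|].
    intros [a b] Hh.
    assert (Ha := Rabs_Re_le (a, b)). assert (Hb := Rabs_Im_le (a, b)).
    assert (M1 := Rmin_l d1 d2). assert (M2 := Rmin_r d1 d2).
    simpl in *.
    specialize (Hd1 (x + a) (y + b)). specialize (Hd2 (x + a) (y + b)).
    replace (x + a - x) with a in * by ring. replace (y + b - y) with b in * by ring.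
    specialize (Hd1 ltac:(lra) ltac:(lra)). specialize (Hd2 ltac:(lra) ltac:(lra)).
    assert (Hx := Rmax_Cmod (a, b)). simpl in Hx.
    eapply Rle_trans; [apply Cmod_le_sum|].
    change ((x, y) + (a, b))%C with ((x + a)%R, (y + b)%R).
    replace (fst (f ((x + a)%R, (y + b)%R) - f (x, y) - (a, b) * l)%C) with
      (Re (f (x + a, y + b)%R) - Re (f (x, y)) - (Re l * a + - Im l * b))
      by (unfold Re, Im; simpl; ring).
    replace (snd (f ((x + a)%R, (y + b)%R) - f (x, y) - (a, b) * l)%C) with
      (Im (f (x + a, y + b)%R) - Im (f (x, y)) - (Im l * a + Re l * b))
      by (unfold Re, Im; simpl; ring).
    nra.
Qed.

Lemma cderiv_const (a z : C) : cderiv (fun _ => a) z 0.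
Proof. exact (is_derive_const (K := C_AbsRing) (V := C_NormedModule) a z). Qed.

Lemma cderiv_id (z : C) : cderiv (fun x => x) z 1.
Proof.
  apply cderiv_eps. intros eps He. exists 1; split; [lra|]. intros h _.
  replace (z + h - z - h * 1)%C with (RtoC 0) by ring. rewrite Cmod_0.
  assert (H := Cmod_ge_0 h). nra.
Qed.

Lemma cderiv_plus (f g : C -> C) (z a b : C) :
  cderiv f z a -> cderiv g z b -> cderiv (fun x => f x + g x)%C z (a + b)%C.
Proof. exact (is_derive_plus (K := C_AbsRing) (V := C_NormedModule) f g z a b). Qed.

(** [C_NormedModule] and [AbsRing_NormedModule C_AbsRing] carry the same norm on C. The product
    rule, and the chain rule for its inner function, are phrased with the second. *)
Lemma cderiv_self (f : C -> C) (z l : C) :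
  cderiv f z l <-> is_derive (K := C_AbsRing) (V := AbsRing_NormedModule C_AbsRing) f z l.
Proof.
  split; intros [_ H]; (split; [apply is_linear_scal_l | exact H]).
Qed.

Lemma cderiv_mult (f g : C -> C) (z a b : C) :
  cderiv f z a -> cderiv g z b ->
  cderiv (fun x => f x * g x)%C z (a * g z + f z * b)%C.
Proof.
  intros Hf Hg.
  apply cderiv_self, (is_derive_mult (K := C_AbsRing) f g z a b); [| |exact Cmult_comm];
    apply cderiv_self; assumption.
Qed.

Lemma cderiv_comp (f g : C -> C) (z a b : C) :
  cderiv f (g z) a -> cderiv g z b -> cderiv (fun x => f (g x)) z (b * a)%C.
Proof.
  intros Hf Hg.
  exact (is_derive_comp (K := C_AbsRing) (V := C_NormedModule) f g z a b Hf
    (proj1 (cderiv_self _ _ _) Hg)).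
Qed.

Lemma cderiv_ext_disk (f g : C -> C) (z l : C) :
  disk z -> (forall x, disk x -> f x = g x) -> cderiv f z l -> cderiv g z l.
Proof.
  intros Hz Hfg. rewrite !cderiv_eps. intros H eps He.
  destruct (H eps He) as [d [Hd0 Hd]]. unfold disk in Hz.
  exists (Rmin d (1 - Cmod z)). split; [apply Rmin_pos; lra|]. intros h Hh.
  assert (M1 := Rmin_l d (1 - Cmod z)). assert (M2 := Rmin_r d (1 - Cmod z)).
  rewrite <- !Hfg; [apply Hd; lra | exact Hz |].
  unfold disk. assert (T := Cmod_triangle z h). lra.
Qed.

Lemma cderiv_ext (f g : C -> C) (z l : C) :
  (forall x, f x = g x) -> cderiv f z l -> cderiv g z l.
Proof. exact (is_derive_ext (K := C_AbsRing) (V := C_NormedModule) f g z l). Qed.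

Lemma Cmod_sub_le (a b : C) : Cmod a - Cmod b <= Cmod (a - b)%C.
Proof.
  assert (T := Cmod_triangle (a - b) b).
  replace (a - b + b)%C with a in T by ring. lra.
Qed.

Lemma cderiv_inv_id (z : C) : z <> 0 -> cderiv Cinv z (- / (z * z))%C.
Proof.
  intros Hz. assert (Hp := proj1 (Cmod_gt_0 z) Hz).
  apply cderiv_eps. intros eps He.
  set (m := Cmod z) in *.
  (* The remainder is h^2 / (z^2 (z + h)). The first bound keeps |z + h| >= m / 2, so the remainder
     is at most 2 |h|^2 / m^3; the second makes this at most eps |h|. *)
  exists (Rmin (m / 2) (eps * (m * m * m) / 2)).
  assert (Hm3 : 0 < m * m * m) by (repeat apply Rmult_lt_0_compat; lra).
  split; [apply Rmin_pos; [lra|]; apply Rdiv_lt_0_compat; [apply Rmult_lt_0_compat|]; lra|].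
  intros h Hh.
  assert (M1 := Rmin_l (m / 2) (eps * (m * m * m) / 2)).
  assert (M2 := Rmin_r (m / 2) (eps * (m * m * m) / 2)).
  assert (Hzh : m / 2 <= Cmod (z + h)).
  { assert (T := Cmod_sub_le z (- h)). rewrite Cmod_opp in T.
    replace (z - - h)%C with (z + h)%C in T by ring. fold m in T. lra. }
  assert (Hn : (z + h)%C <> 0).
  { apply Cmod_gt_0. lra. }
  replace (/ (z + h) - / z - h * - / (z * z))%C with (h * (h / (z * z * (z + h))))%C
    by (field; auto).
  rewrite Cmod_mult, Cmod_div by (repeat apply Cmult_neq_0; auto).
  rewrite !Cmod_mult. fold m.
  rewrite (Rmult_comm eps). apply Rmult_le_compat_l; [apply Cmod_ge_0|].
  apply Rle_div_l; [repeat apply Rmult_lt_0_compat; lra|].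
  assert (0 < m * m) by nra.
  apply Rle_trans with (eps * (m * m * (m / 2))); [lra|].
  apply Rmult_le_compat_l; [lra|]. apply Rmult_le_compat_l; lra.
Qed.

Lemma cderiv_div (f g : C -> C) (z a b : C) :
  cderiv f z a -> cderiv g z b -> g z <> 0 ->
  cderiv (fun x => f x / g x)%C z ((a * g z - f z * b) / (g z * g z))%C.
Proof.
  intros Hf Hg Hn.
  assert (H := cderiv_mult _ _ _ _ _ Hf (cderiv_comp _ _ _ _ _ (cderiv_inv_id _ Hn) Hg)).
  unfold Cdiv at 1. replace ((a * g z - f z * b) / (g z * g z))%C with
    (a * / g z + f z * (b * - / (g z * g z)))%C by (field; exact Hn).
  exact H.
Qed.

(** * The complex exponential *)

Lemma Cexp_plus (a b : C) : Cexp (a + b) = (Cexp a * Cexp b)%C.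
Proof.
  destruct a as [a1 a2], b as [b1 b2]. unfold Cexp, Re, Im; simpl.
  rewrite exp_plus, cos_plus, sin_plus.
  apply injective_projections; simpl; ring.
Qed.

Lemma Cmod_Cexp (z : C) : Cmod (Cexp z) = exp (Re z).
Proof.
  unfold Cmod, Cexp; simpl.
  replace (_ + _) with (exp (Re z) * exp (Re z) * ((sin (Im z))² + (cos (Im z))²))
    by (unfold Rsqr; ring).
  rewrite sin2_cos2, Rmult_1_r. apply sqrt_square. left; apply exp_pos.
Qed.

Lemma Cexp_neq_0 (z : C) : Cexp z <> 0.
Proof. apply Cmod_gt_0. rewrite Cmod_Cexp. apply exp_pos. Qed.

Lemma Cexp_0 : Cexp 0 = 1.
Proof. unfold Cexp; simpl. rewrite exp_0, cos_0, sin_0. apply injective_projections; simpl; ring. Qed.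

Lemma Cexp_opp (z : C) : Cexp (- z) = (/ Cexp z)%C.
Proof.
  assert (H : (Cexp (- z) * Cexp z = 1)%C).
  { rewrite <- Cexp_plus. replace (- z + z)%C with (RtoC 0) by ring. apply Cexp_0. }
  replace (Cexp (- z)) with (Cexp (- z) * Cexp z * / Cexp z)%C
    by (field; apply Cexp_neq_0).
  rewrite H. ring.
Qed.

Lemma differentiable_of_partials (f fx : R -> R -> R) (x y fy : R) :
  locally (x, y) (fun p : R * R => is_derive (fun t => f t (snd p)) (fst p) (fx (fst p) (snd p))) ->
  is_derive (fun t => f x t) y fy ->
  continuous (fun p : R * R => fx (fst p) (snd p)) (x, y) ->
  differentiable_pt_lim f x y (fx x y) fy.
Proof.
  intros H1 H2 H3. apply filterdiff_differentiable_pt_lim.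
  exact (is_derive_filterdiff f x y fx fy H1 H2 H3).
Qed.

Lemma cderiv_Cexp (z : C) : cderiv Cexp z (Cexp z).
Proof.
  destruct z as [x y]. apply cderiv_CR. unfold Cexp, Re, Im; simpl. split.
  - apply (differentiable_of_partials (fun u v => exp u * cos v) (fun u v => exp u * cos v)).
    + apply filter_forall. intros [u v]; simpl. auto_derive; auto. ring.
    + auto_derive; auto. ring.
    + apply (continuous_mult (fun p : R * R => exp (fst p)) (fun p : R * R => cos (snd p)));
      apply continuous_comp; try apply continuous_fst; try apply continuous_snd;
      [apply continuous_exp | apply continuous_cos].
  - apply (differentiable_of_partials (fun u v => exp u * sin v) (fun u v => exp u * sin v)).
    + apply filter_forall. intros [u v]; simpl. auto_derive; auto. ring.
    + auto_derive; auto. ring.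
    + apply (continuous_mult (fun p : R * R => exp (fst p)) (fun p : R * R => sin (snd p)));
      apply continuous_comp; try apply continuous_fst; try apply continuous_snd;
      [apply continuous_exp | apply continuous_sin].
Qed.

(** * The complex logarithm and curves *)

Lemma Re_div_Cmod_bound (z : C) : z <> 0 -> -1 <= Re z / Cmod z <= 1.
Proof.
  intros Hz. apply Cmod_gt_0 in Hz.
  assert (H := Rabs_Re_le z). apply Rabs_le_between in H.
  split; [apply Rle_div_r | apply Rle_div_l]; unfold Re; lra.
Qed.

Lemma sqrt_1_Re_div_Cmod (z : C) : z <> 0 ->
  sqrt (1 - (Re z / Cmod z)²) = Rabs (Im z) / Cmod z.
Proof.
  intros Hz. apply Cmod_gt_0 in Hz.
  replace (1 - (Re z / Cmod z)²) with ((Im z / Cmod z)²).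
  - rewrite sqrt_Rsqr_abs. unfold Rdiv. rewrite Rabs_mult, Rabs_inv.
    now rewrite (Rabs_right (Cmod z)) by lra.
  - assert (H := Cmod2_alt z). unfold Rsqr.
    transitivity ((Cmod z ^ 2 - Re z ^ 2) / Cmod z ^ 2); [|field; lra].
    replace (Cmod z ^ 2 - Re z ^ 2) with (Im z ^ 2) by lra. field. lra.
Qed.

Lemma Carg_bound (z : C) : - PI <= Carg z <= PI.
Proof.
  unfold Carg. assert (H := acos_bound (Re z / Cmod z)).
  destruct (Rle_dec 0 (Im z)); lra.
Qed.

Lemma Cmod_Carg (z : C) : z <> 0 ->
  (Cmod z * cos (Carg z), Cmod z * sin (Carg z)) = z.
Proof.
  intros Hz. assert (Hm := proj1 (Cmod_gt_0 z) Hz).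
  assert (Hc : cos (Carg z) = Re z / Cmod z).
  { unfold Carg. destruct (Rle_dec 0 (Im z)); [|rewrite cos_neg];
      apply cos_acos, Re_div_Cmod_bound, Hz. }
  assert (Hs : sin (Carg z) = Im z / Cmod z).
  { unfold Carg. destruct (Rle_dec 0 (Im z)) as [H|H]; [|rewrite sin_neg];
      rewrite sin_acos by (apply Re_div_Cmod_bound, Hz);
      rewrite sqrt_1_Re_div_Cmod by exact Hz;
      [rewrite Rabs_right by lra | rewrite Rabs_left by lra]; field; lra. }
  rewrite Hc, Hs. destruct z as [x y]. unfold Re, Im; cbn [fst snd].
  apply injective_projections; cbn [fst snd]; field; lra.
Qed.

Lemma Cexp_Cln (z : C) : z <> 0 -> Cexp (Cln z) = z.
Proof.
  intros Hz. rewrite <- (Cmod_Carg z Hz) at 2.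
  unfold Cexp, Cln, Re, Im; cbn [fst snd].
  rewrite exp_ln by (now apply Cmod_gt_0). reflexivity.
Qed.

(** On the right half plane the two cases of [Carg] merge into one formula that is smooth across the
    real axis, as differentiating [Cln] requires. *)
Lemma Carg_atan (x y : R) : 0 < x -> Carg (x, y) = atan (y / x).
Proof.
  intros Hx.
  assert (Hz : (x, y) <> RtoC 0) by (intros H; injection H; lra).
  assert (Hm := proj1 (Cmod_gt_0 _) Hz).
  unfold Carg.
  rewrite acos_atan by (apply Rdiv_lt_0_compat; assumption).
  rewrite sqrt_1_Re_div_Cmod by exact Hz.
  replace (Rabs (Im (x, y)) / Cmod (x, y) / (Re (x, y) / Cmod (x, y)))
    with (Rabs y / x) by (unfold Re, Im; cbn [fst snd]; field; lra).
  cbn [Im snd]. unfold Im; cbn [snd].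
  destruct (Rle_dec 0 y).
  - now rewrite Rabs_right by lra.
  - rewrite Rabs_left by lra. rewrite <- atan_opp. f_equal. field. lra.
Qed.

Lemma Cln_half_plane (x y : R) : 0 < x ->
  Cln (x, y) = (ln (x * x + y * y) / 2, atan (y / x)).
Proof.
  intros Hx. unfold Cln. rewrite Carg_atan by exact Hx. f_equal.
  unfold Cmod; cbn [fst snd].
  assert (H : 0 < x * x + y * y) by nra.
  replace (x ^ 2 + y ^ 2) with (x * x + y * y) by ring.
  rewrite <- (sqrt_sqrt (x * x + y * y)) at 2 by lra.
  rewrite ln_mult by (apply sqrt_lt_R0; exact H). field.
Qed.

(** The half plane covers every later use: 1 + t, 1 - 2t - t^2 and 1 - z all have positive real
    part. There [Cln] agrees with the explicit [L], whose partial derivatives are rational, and the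
    agreement persists on a ball of radius [Re z]. *)
Lemma cderiv_Cln (z : C) : 0 < Re z -> cderiv Cln z (/ z)%C.
Proof.
  intros Hz.
  set (L := fun w : C =>
    (ln (Re w * Re w + Im w * Im w) / 2, atan (Im w / Re w)) : C).
  assert (HL : cderiv L z (/ z)%C).
  { destruct z as [x y]. change (0 < x) in Hz.
    assert (Hd : 0 < x * x + y * y) by nra.
    assert (Hloc : locally (x, y) (fun p : R * R => 0 < fst p)).
    { exists (mkposreal x Hz). intros [u v] [Hu _].
      change (Rabs (u - x) < x) in Hu. apply Rabs_lt_between in Hu. simpl. lra. }
    assert (Hcont : forall N : R * R -> R, continuous N (x, y) ->
      continuous (fun p : R * R => N p / (fst p * fst p + snd p * snd p)) (x, y)).
    { intros N HN. apply (continuous_mult N); [exact HN|].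
      apply (continuous_comp (fun p : R * R => fst p * fst p + snd p * snd p) Rinv).
      - apply (continuous_plus (fun p : R * R => fst p * fst p) (fun p : R * R => snd p * snd p)).
        + apply (continuous_mult (@fst R R) (@fst R R)); apply continuous_fst.
        + apply (continuous_mult (@snd R R) (@snd R R)); apply continuous_snd.
      - apply continuous_Rinv. simpl. lra. }
    apply cderiv_CR. unfold L, Cinv, Re, Im; cbn [fst snd]. split.
    - replace (x / (x ^ 2 + y ^ 2)) with (x / (x * x + y * y)) by (f_equal; ring).
      apply (differentiable_of_partials (fun u v => ln (u * u + v * v) / 2)
        (fun u v => u / (u * u + v * v))).
      + eapply filter_imp; [|exact Hloc]. intros [u v]; cbn [fst snd]. intros Hu.
        assert (0 < u * u + v * v) by nra.
        auto_derive; [assumption|]. field. lra.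
      + auto_derive; [assumption|]. field. nra.
      + apply Hcont, continuous_fst.
    - replace (- y / (x ^ 2 + y ^ 2)) with (- y / (x * x + y * y)) by (f_equal; ring).
      apply (differentiable_of_partials (fun u v => atan (v / u))
        (fun u v => - v / (u * u + v * v))).
      + eapply filter_imp; [|exact Hloc]. intros [u v]; cbn [fst snd]. intros Hu.
        assert (0 < u * u + v * v) by nra.
        auto_derive; [lra|]. field. split; [lra|nra].
      + auto_derive; [lra|]. field. split; nra.
      + apply Hcont. apply (continuous_opp (@snd R R)), continuous_snd. }
  revert HL. rewrite !cderiv_eps. intros H eps He.
  destruct (H eps He) as [d [Hd0 Hd]].
  exists (Rmin d (Re z)). split; [apply Rmin_pos; lra|]. intros h Hh.
  assert (M1 := Rmin_l d (Re z)). assert (M2 := Rmin_r d (Re z)).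
  assert (E : forall w : C, 0 < Re w -> Cln w = L w).
  { intros [u v] Hu. now apply Cln_half_plane. }
  rewrite !E; [apply Hd; lra | exact Hz |].
  assert (T := Rabs_Re_le h). assert (T2 := Rabs_maj2 (fst h)).
  destruct z as [x y], h as [a b]. unfold Re in *; simpl in *. lra.
Qed.

(** * Derivatives of curves and mean value inequalities *)

Definition rderiv (g : R -> C) (t : R) (d : C) : Prop :=
  is_derive (fun s => Re (g s)) t (Re d) /\ is_derive (fun s => Im (g s)) t (Im d).

Lemma rderiv_comp (f : C -> C) (g : R -> C) (t : R) (l d : C) :
  cderiv f (g t) l -> rderiv g t d -> rderiv (fun s => f (g s)) t (l * d)%C.
Proof.
  intros Hf [H1 H2].
  rewrite (surjective_pairing (g t)) in Hf. apply cderiv_CR in Hf. destruct Hf as [F1 F2].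
  apply is_derive_Reals in H1. apply is_derive_Reals in H2.
  split; apply is_derive_Reals.
  - assert (A := derivable_pt_lim_comp_2d _ _ _ _ _ _ _ _ F1 H1 H2).
    replace (Re (l * d)) with (Re l * Re d + - Im l * Im d) by (unfold Re, Im; simpl; ring).
    revert A. apply derivable_pt_lim_ext. intros s. unfold Re, Im. now rewrite <- surjective_pairing.
  - assert (A := derivable_pt_lim_comp_2d _ _ _ _ _ _ _ _ F2 H1 H2).
    replace (Im (l * d)) with (Im l * Re d + Re l * Im d) by (unfold Re, Im; simpl; ring).
    revert A. apply derivable_pt_lim_ext. intros s. unfold Re, Im. now rewrite <- surjective_pairing.
Qed.

Lemma rderiv_line (a b : C) (t : R) : rderiv (fun s => a + s * b)%C t b.
Proof.
  destruct a as [a1 a2], b as [b1 b2].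
  split; unfold Re, Im; simpl; auto_derive; auto; ring.
Qed.

Lemma rderiv_mult_const_l (c : C) (g : R -> C) (t : R) (d : C) :
  rderiv g t d -> rderiv (fun s => c * g s)%C t (c * d)%C.
Proof.
  intros H. apply (rderiv_comp (fun w => c * w)%C g t c d); [|exact H].
  assert (A := cderiv_mult _ _ _ _ _ (cderiv_const c (g t)) (cderiv_id (g t))).
  cbn beta in A. replace (0 * g t + c * 1)%C with c in A by ring. exact A.
Qed.

Lemma mean_value_le (f f' : R -> R) :
  (forall t, 0 <= t <= 1 -> is_derive f t (f' t) /\ f' t <= 0) -> f 1 <= f 0.
Proof.
  intros H.
  destruct (MVT_gen f 0 1 f') as [c [Hc E]];
    rewrite Rmin_left, Rmax_right in * by lra.
  - intros x Hx. apply H; lra.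
  - intros x Hx. apply continuity_pt_filterlim.
    apply (ex_derive_continuous f). exists (f' x). now apply H.
  - destruct (H c Hc). lra.
Qed.

(** Multiplying by the conjugate of D = g 1 - g 0 turns the increment into the real number |D|^2, so
    the real mean value theorem applies to Re (c g) - |D| b. *)
Lemma mean_value_Cmod (g g' : R -> C) (b b' : R -> R) :
  (forall t, 0 <= t <= 1 -> rderiv g t (g' t) /\ is_derive b t (b' t) /\
    Cmod (g' t) <= b' t) ->
  Cmod (g 1 - g 0)%C <= b 1 - b 0.
Proof.
  intros H.
  set (D := (g 1 - g 0)%C).
  set (c := Cconj D).
  assert (E : Re (c * g 1)%C - Re (c * g 0)%C = Cmod D * Cmod D).
  { assert (A := Cmod2_alt D). replace (Cmod D * Cmod D) with (Cmod D ^ 2) by ring.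
    rewrite A. unfold c, D, Re, Im; simpl. ring. }
  assert (K : Re (c * g 1)%C - Cmod D * b 1 <= Re (c * g 0)%C - Cmod D * b 0).
  { apply (mean_value_le (fun t => Re (c * g t)%C - Cmod D * b t)
      (fun t => Re (c * g' t)%C - Cmod D * b' t)).
    intros t Ht. destruct (H t Ht) as [H1 [H2 H3]]. split.
    - apply (is_derive_minus (V := R_NormedModule) (fun t => Re (c * g t)%C) (fun t => Cmod D * b t)).
      + apply (rderiv_mult_const_l c g t (g' t) H1).
      + apply is_derive_scal. exact H2.
    - assert (A := Re_le_Cmod (c * g' t)%C). rewrite Cmod_mult in A.
      unfold c in A at 2. rewrite Cmod_conj in A. assert (B := Cmod_ge_0 D). nra. }
  destruct (Cmod_ge_0 D) as [P|P].
  - apply Rmult_le_reg_l with (Cmod D); [exact P|]. lra.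
  (* When D = 0 there is nothing to divide by; [b] is nondecreasing because b' >= |g'| >= 0. *)
  - assert (Hb : b 0 <= b 1); [|lra].
    apply Ropp_le_cancel.
    apply (mean_value_le (fun t => - b t) (fun t => - b' t)).
    intros t Ht. destruct (H t Ht) as [_ [H2 H3]]. split.
    + apply (is_derive_opp (V := R_NormedModule) b). exact H2.
    + assert (A := Cmod_ge_0 (g' t)). lra.
Qed.

(** * Power series *)

Notation Cis_series := (is_series (K := C_AbsRing) (V := C_NormedModule)).

Lemma sum_n_pair (u : nat -> C) (n : nat) :
  sum_n (G := C_AbelianMonoid) u n = (sum_n (fun k => Re (u k)) n, sum_n (fun k => Im (u k)) n).
Proof.
  induction n as [|n IH].
  - rewrite !sum_O. apply surjective_pairing.
  - rewrite !sum_Sn, IH. reflexivity.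
Qed.

Lemma is_series_pair (u : nat -> C) (l : C) :
  Cis_series u l <->
  is_series (fun n => Re (u n)) (Re l) /\ is_series (fun n => Im (u n)) (Im l).
Proof.
  unfold is_series. split.
  - intros H. split.
    + apply (filterlim_ext (fun n => fst (sum_n (G := C_AbelianMonoid) u n))).
      { intros n. now rewrite sum_n_pair. }
      eapply filterlim_comp; [exact H|]. apply (continuous_fst (U := R_UniformSpace) (V := R_UniformSpace)).
    + apply (filterlim_ext (fun n => snd (sum_n (G := C_AbelianMonoid) u n))).
      { intros n. now rewrite sum_n_pair. }
      eapply filterlim_comp; [exact H|]. apply (continuous_snd (U := R_UniformSpace) (V := R_UniformSpace)).
  - intros [H1 H2] P [eps HP].
    destruct (H1 _ (locally_ball (Re l) eps)) as [N1 HN1].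
    destruct (H2 _ (locally_ball (Im l) eps)) as [N2 HN2].
    exists (max N1 N2). intros n Hn. apply HP.
    change (ball l eps (sum_n (G := C_AbelianMonoid) u n)).
    rewrite sum_n_pair. split; [apply HN1 | apply HN2]; lia.
Qed.

Lemma is_series_nonneg (b : nat -> R) (L : R) :
  is_series b L -> (forall n, 0 <= b n) -> 0 <= L.
Proof.
  intros Hb H.
  refine (is_lim_seq_le (fun _ => 0) _ (Finite 0) (Finite _) _ (is_lim_seq_const 0) Hb).
  intros n. assert (Z : sum_n (fun _ : nat => 0) n = 0) by (rewrite sum_n_const; apply Rmult_0_r).
  rewrite <- Z. now apply (sum_n_m_le _ _ 0 n).
Qed.

(** The conjugate trick again: multiplied by the conjugate of [l], the sum has real part |l|^2, and
    the real series is compared termwise with |l| b. *)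
Lemma Cmod_is_series_le (u : nat -> C) (l : C) (b : nat -> R) (L : R) :
  Cis_series u l -> is_series b L -> (forall n, Cmod (u n) <= b n) -> Cmod l <= L.
Proof.
  intros Hu Hb H. apply is_series_pair in Hu. destruct Hu as [H1 H2].
  set (c := Cconj l).
  assert (A : is_series (fun n => Re (c * u n)%C) (Cmod l * Cmod l)).
  { apply (is_series_scal (V := R_NormedModule) (Re l)) in H1.
    apply (is_series_scal (V := R_NormedModule) (Im l)) in H2.
    assert (B := is_series_plus _ _ _ _ H1 H2).
    replace (Cmod l * Cmod l) with (plus (scal (Re l) (Re l)) (scal (Im l) (Im l))).
    - eapply is_series_ext; [|exact B]. intros n. unfold c, Re, Im; simpl.
      unfold plus, scal; simpl. unfold mult; simpl. ring.
    - assert (E := Cmod2_alt l). unfold plus, scal; simpl. unfold mult; simpl. lra. }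
  destruct (Cmod_ge_0 l) as [P|P].
  - apply Rmult_le_reg_l with (Cmod l); [exact P|].
    apply (is_series_scal (V := R_NormedModule) (Cmod l)) in Hb.
    refine (is_lim_seq_le _ _ (Finite _) (Finite _) _ A Hb). intros n.
    apply (sum_n_m_le _ _ 0 n). intros k. change (Re (c * u k)%C <= Cmod l * b k).
    eapply Rle_trans; [apply Re_le_Cmod|]. rewrite Cmod_mult. unfold c. rewrite Cmod_conj.
    apply Rmult_le_compat_l; [lra|apply H].
  - rewrite <- P. apply (is_series_nonneg b L Hb). intros n.
    eapply Rle_trans; [apply Cmod_ge_0 | apply H].
Qed.

(** Radius of convergence at least 1, in the form of Abel's lemma. Boundedness against every rho < 1
    passes easily to shifts and to factors n + 1, hence to the derived series. *)
Definition tempered (a : nat -> C) : Prop :=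
  forall rho, 0 < rho < 1 -> exists M, forall n, Cmod (a n) * rho ^ n <= M.

Definition psum (a : nat -> C) (z : C) : C :=
  (Series (fun n => Re (a n * z ^ n)%C), Series (fun n => Im (a n * z ^ n)%C)).

Lemma psum_unique (a : nat -> C) (z l : C) :
  Cis_series (fun n => a n * z ^ n)%C l -> psum a z = l.
Proof.
  intros H. apply is_series_pair in H. destruct H as [H1 H2].
  unfold psum. rewrite (is_series_unique _ _ H1), (is_series_unique _ _ H2).
  symmetry; apply surjective_pairing.
Qed.

(** Terms of a convergent series are bounded. The point 0 is left out because the series to be
    treated arises by dividing by z^2. *)
Lemma tempered_of_convergent (a : nat -> C) :
  (forall z, disk z -> z <> 0 -> exists l, Cis_series (fun n => a n * z ^ n)%C l) -> tempered a.
Proof.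
  intros H rho Hrho.
  destruct (H (RtoC rho)) as [l Hl].
  { unfold disk. rewrite Cmod_R, Rabs_right; lra. }
  { intros E. apply RtoC_inj in E. lra. }
  apply is_series_pair in Hl. destruct Hl as [H1 H2].
  assert (B : forall u l, is_series u l -> exists M, forall n, Rabs (u n) <= M).
  { intros u l' Hu. assert (L := ex_series_lim_0 u (ex_intro _ l' Hu)).
    apply is_lim_seq_Reals in L. destruct (maj_by_pos u (exist _ 0 L)) as [M [_ HM]].
    now exists M. }
  destruct (B _ _ H1) as [M1 HM1]. destruct (B _ _ H2) as [M2 HM2].
  exists (M1 + M2). intros n.
  replace (Cmod (a n) * rho ^ n) with (Cmod (a n * RtoC rho ^ n)%C).
  - eapply Rle_trans; [apply Cmod_le_sum|]. specialize (HM1 n). specialize (HM2 n).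
    unfold Re, Im in *. lra.
  - rewrite Cmod_mult, Cmod_pow, Cmod_R, (Rabs_right rho); lra.
Qed.

Lemma tempered_summable (a : nat -> C) (r : R) :
  tempered a -> 0 <= r < 1 -> ex_series (fun n => Cmod (a n) * r ^ n).
Proof.
  intros Ha Hr. set (rho := (1 + r) / 2).
  assert (Hrho : 0 < rho < 1) by (unfold rho; lra).
  destruct (Ha rho Hrho) as [M HM].
  apply (ex_series_le (V := R_CompleteNormedModule) _ (fun n => M * (r / rho) ^ n)).
  - intros n. unfold norm; simpl. unfold abs; simpl.
    assert (0 <= r ^ n) by (apply pow_le; lra).
    rewrite Rabs_right; [|apply Rle_ge, Rmult_le_pos; [apply Cmod_ge_0|assumption]].
    assert (Hp : 0 < rho ^ n) by (apply pow_lt; lra).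
    unfold Rdiv. rewrite Rpow_mult_distr, pow_inv.
    replace (Cmod (a n) * r ^ n) with ((Cmod (a n) * rho ^ n) * (r ^ n * / rho ^ n))
      by (field; lra).
    apply Rmult_le_compat_r; [|apply HM].
    apply Rmult_le_pos; [assumption|]. left. now apply Rinv_0_lt_compat.
  - apply (ex_series_scal (V := R_NormedModule) M (fun n => (r / rho) ^ n)).
    apply ex_series_geom. rewrite Rabs_right.
    + apply Rlt_div_l; unfold rho; lra.
    + apply Rle_ge, Rmult_le_pos; [lra|]. left. apply Rinv_0_lt_compat. lra.
Qed.

Lemma is_series_psum (a : nat -> C) (z : C) :
  tempered a -> disk z -> Cis_series (fun n => a n * z ^ n)%C (psum a z).
Proof.
  intros Ha Hz.
  assert (S := tempered_summable a (Cmod z) Ha (conj (Cmod_ge_0 z) Hz)).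
  apply is_series_pair. split; apply Series_correct;
    apply (ex_series_le (V := R_CompleteNormedModule) _ (fun n => Cmod (a n) * Cmod z ^ n));
    try exact S; intros n; rewrite <- Cmod_pow, <- Cmod_mult.
  - apply Rabs_Re_le.
  - apply Rabs_Im_le.
Qed.

(** The factor n + 1 is absorbed by moving from [rho] to a larger s < 1: by Bernoulli's inequality
    (s / rho)^n >= 1 + n x with x = s / rho - 1. *)
Lemma tempered_mult_index (a : nat -> C) :
  tempered a -> tempered (fun n => RtoC (INR (n + 1)) * a n)%C.
Proof.
  intros Ha rho Hrho. set (s := (1 + rho) / 2).
  assert (Hs : rho < s < 1) by (unfold s; lra).
  destruct (Ha s) as [M HM]; [lra|].
  set (x := s / rho - 1).
  assert (Hx : 0 < x).
  { unfold x. assert (1 < s / rho) by (apply Rlt_div_r; lra). lra. }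
  exists (M * (/ x + 1)). intros n.
  assert (HB : 1 + INR n * x <= (s / rho) ^ n).
  { assert (P := poly n x Hx). replace (1 + x) with (s / rho) in P by (unfold x; ring). exact P. }
  rewrite Cmod_mult, Cmod_R, Rabs_right by (apply Rle_ge, pos_INR).
  rewrite plus_INR. simpl (INR 1).
  assert (Hsn : 0 < s ^ n) by (apply pow_lt; lra).
  assert (Hrn : 0 < rho ^ n) by (apply pow_lt; lra).
  assert (E : (s / rho) ^ n * rho ^ n = s ^ n).
  { unfold Rdiv. rewrite Rpow_mult_distr, pow_inv. field. lra. }
  assert (Hix := Rinv_0_lt_compat x Hx). assert (Hin := pos_INR n).
  assert (K : (INR n + 1) * rho ^ n <= (/ x + 1) * s ^ n).
  { rewrite <- E, <- Rmult_assoc. apply Rmult_le_compat_r; [lra|].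
    apply Rle_trans with ((/ x + 1) * (1 + INR n * x)).
    - replace ((/ x + 1) * (1 + INR n * x)) with (/ x + 1 + INR n + INR n * x) by (field; lra).
      assert (0 <= INR n * x) by (apply Rmult_le_pos; lra). lra.
    - apply Rmult_le_compat_l; lra. }
  specialize (HM n). assert (H0 := Cmod_ge_0 (a n)).
  apply Rle_trans with (Cmod (a n) * ((/ x + 1) * s ^ n)).
  - replace ((INR n + 1) * Cmod (a n) * rho ^ n) with (Cmod (a n) * ((INR n + 1) * rho ^ n)) by ring.
    apply Rmult_le_compat_l; assumption.
  - replace (Cmod (a n) * ((/ x + 1) * s ^ n)) with ((Cmod (a n) * s ^ n) * (/ x + 1)) by ring.
    apply Rmult_le_compat_r; lra.
Qed.

Lemma tempered_shift (a : nat -> C) : tempered a -> tempered (fun n => a (n + 1)%nat).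
Proof.
  intros Ha rho Hrho. destruct (Ha rho Hrho) as [M HM]. exists (M / rho). intros n.
  specialize (HM (n + 1)%nat). rewrite pow_add, pow_1 in HM.
  apply -> Rle_div_r; [|lra]. lra.
Qed.

Definition dcoef (a : nat -> C) (n : nat) : C := (RtoC (INR (n + 1)) * a (n + 1)%nat)%C.

Lemma tempered_dcoef (a : nat -> C) : tempered a -> tempered (dcoef a).
Proof. intros Ha. exact (tempered_mult_index _ (tempered_shift _ Ha)). Qed.

(** Induction on the remainder: E_(n+1) = (z + h) E_n + (n + 1) h^2 z^n. The factor [rho] on the
    left stands for an exponent n - 1 on the right, which would be truncated at n = 0. *)
Lemma pow_taylor_bound (z h : C) (rho : R) (n : nat) :
  Cmod z <= rho -> Cmod (z + h) <= rho ->
  rho * Cmod ((z + h) ^ (n + 1) - z ^ (n + 1) - h * (RtoC (INR (n + 1)) * z ^ n))%C <=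
  INR (n + 1) ^ 2 * Cmod h ^ 2 * rho ^ n.
Proof.
  intros Hz Hzh. assert (Hh := Cmod_ge_0 h). assert (Hr := Rle_trans _ _ _ (Cmod_ge_0 z) Hz).
  induction n as [|n IH].
  - simpl (INR (0 + 1)). simpl (0 + 1)%nat.
    replace ((z + h) ^ 1 - z ^ 1 - h * (1 * z ^ 0))%C with (RtoC 0)
      by (rewrite !Cpow_1_r; change (z ^ 0)%C with (RtoC 1); ring).
    rewrite Cmod_0, Rmult_0_r, pow_O, Rmult_1_r, pow1, Rmult_1_l. apply pow2_ge_0.
  - set (E := ((z + h) ^ (n + 1) - z ^ (n + 1) - h * (RtoC (INR (n + 1)) * z ^ n))%C) in *.
    assert (EQ : ((z + h) ^ (S n + 1) - z ^ (S n + 1) - h * (RtoC (INR (S n + 1)) * z ^ S n)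
      = (z + h) * E + RtoC (INR (n + 1)) * (h * h) * z ^ n)%C).
    { unfold E. rewrite !Cpow_add_r, !Cpow_1_r, !Cpow_S.
      replace (INR (S n + 1)) with (INR (n + 1) + 1).
      - rewrite RtoC_plus. ring.
      - rewrite <- S_INR. f_equal. }
    rewrite EQ.
    assert (P : Cmod z ^ n <= rho ^ n) by (apply pow_incr; split; [apply Cmod_ge_0|assumption]).
    assert (I0 := pos_INR (n + 1)).
    assert (T := Cmod_triangle ((z + h) * E) (RtoC (INR (n + 1)) * (h * h) * z ^ n)).
    rewrite !Cmod_mult, Cmod_pow, Cmod_R, Rabs_right in T by lra.
    assert (HE := Cmod_ge_0 E).
    assert (A1 : Cmod (z + h) * Cmod E <= rho * Cmod E) by (apply Rmult_le_compat_r; assumption).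
    assert (A2 : INR (n + 1) * (Cmod h * Cmod h) * Cmod z ^ n <=
                 INR (n + 1) * (Cmod h * Cmod h) * rho ^ n).
    { apply Rmult_le_compat_l; [|exact P]. apply Rmult_le_pos; [lra|nra]. }
    set (N := INR (n + 1)) in *. set (q := rho ^ n) in *.
    replace (INR (S n + 1)) with (N + 1) by (unfold N; now rewrite <- S_INR).
    replace (rho ^ S n) with (rho * q) by reflexivity.
    assert (Hq : 0 <= q) by (apply pow_le; assumption).
    apply Rle_trans with (rho * (rho * Cmod E + N * (Cmod h * Cmod h) * q)).
    + apply Rmult_le_compat_l; lra.
    + replace ((N + 1) ^ 2 * Cmod h ^ 2 * (rho * q)) with
        (rho * (N ^ 2 * Cmod h ^ 2 * q + (2 * N + 1) * (Cmod h * Cmod h) * q)) by ring.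
      apply Rmult_le_compat_l; [assumption|].
      assert (0 <= (N + 1) * (Cmod h * Cmod h) * q); [|lra].
      apply Rmult_le_pos; [|assumption]. apply Rmult_le_pos; [lra|nra].
Qed.

Lemma psum_incr_1 (a : nat -> C) (z : C) : tempered a -> disk z ->
  Cis_series (fun n => a (n + 1)%nat * z ^ (n + 1))%C (psum a z - a 0%nat)%C.
Proof.
  intros Ha Hz.
  apply (is_series_ext (K := C_AbsRing) (V := C_NormedModule) (fun k => a (S k) * z ^ S k)%C).
  { intros n. now rewrite Nat.add_1_r. }
  apply (is_series_incr_1 (K := C_AbsRing) (V := C_NormedModule) (fun n => a n * z ^ n)%C).
  refine (eq_rect _ (fun l => Cis_series _ l) (is_series_psum a z Ha Hz) _ _).
  change (psum a z = psum a z - a 0%nat + a 0%nat * 1)%C. ring.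
Qed.

(** Termwise differentiation: the remainder of the sum is the sum of the remainders, each quadratic
    in h by [pow_taylor_bound]. *)
Lemma cderiv_psum (a : nat -> C) (z : C) : tempered a -> disk z ->
  cderiv (psum a) z (psum (dcoef a) z).
Proof.
  intros Ha Hz. apply cderiv_eps. intros eps He.
  set (rho := (1 + Cmod z) / 2).
  assert (Hz0 := Cmod_ge_0 z). assert (Hz1 : Cmod z < 1) by exact Hz.
  assert (Hrho : Cmod z < rho < 1 /\ 0 < rho) by (unfold rho; lra).
  (* [K] is the sum of (n + 1)^2 |a_(n+1)| rho^n: one factor n + 1 comes from [dcoef], the other
     from [tempered_mult_index]. *)
  assert (S2 := tempered_summable _ rho (tempered_mult_index _ (tempered_dcoef _ Ha)) ltac:(lra)).
  destruct S2 as [K HK].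
  assert (HK0 : 0 <= K).
  { apply (is_series_nonneg _ _ HK). intros n.
    apply Rmult_le_pos; [apply Cmod_ge_0|]. apply pow_le; lra. }
  exists (Rmin (rho - Cmod z) (eps * rho / (K + 1))).
  split. { apply Rmin_pos; [lra|]. apply Rdiv_lt_0_compat; [|lra]. apply Rmult_lt_0_compat; lra. }
  intros h Hh. assert (Hh0 := Cmod_ge_0 h).
  assert (M1 := Rmin_l (rho - Cmod z) (eps * rho / (K + 1))).
  assert (M2 := Rmin_r (rho - Cmod z) (eps * rho / (K + 1))).
  assert (Hzh : Cmod (z + h) <= rho) by (assert (T := Cmod_triangle z h); lra).
  assert (D2 : disk (z + h)) by (unfold disk; lra).
  assert (A := psum_incr_1 a (z + h) Ha D2).
  assert (B := psum_incr_1 a z Ha Hz).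
  assert (D := is_series_psum _ z (tempered_dcoef _ Ha) Hz).
  apply (is_series_scal (K := C_AbsRing) (V := C_NormedModule) h) in D.
  assert (E := is_series_minus _ _ _ _ (is_series_minus _ _ _ _ A B) D).
  assert (F := Cmod_is_series_le _ _ _ _ E
    (is_series_scal (V := R_NormedModule) (Cmod h ^ 2 / rho) _ _ HK)).
  replace (psum a (z + h) - psum a z - h * psum (dcoef a) z)%C with
    (plus (plus (psum a (z + h) - a 0%nat)%C (opp (psum a z - a 0%nat)%C))
          (opp (scal h (psum (dcoef a) z)))).
  2:{ change (psum a (z + h) - a 0%nat + - (psum a z - a 0%nat) + - (h * psum (dcoef a) z) =
       psum a (z + h) - psum a z - h * psum (dcoef a) z)%C. ring. }
  eapply Rle_trans; [apply F|].
  - intros n.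
    change (Cmod (a (n + 1)%nat * (z + h) ^ (n + 1) + - (a (n + 1)%nat * z ^ (n + 1)) +
      - (h * (dcoef a n * z ^ n)))%C <=
      Cmod h ^ 2 / rho * (Cmod (RtoC (INR (n + 1)) * dcoef a n) * rho ^ n)).
    unfold dcoef.
    replace (a (n + 1)%nat * (z + h) ^ (n + 1) + - (a (n + 1)%nat * z ^ (n + 1)) +
      - (h * (RtoC (INR (n + 1)) * a (n + 1)%nat * z ^ n)))%C with
      (a (n + 1)%nat * ((z + h) ^ (n + 1) - z ^ (n + 1) - h * (RtoC (INR (n + 1)) * z ^ n)))%C
      by ring.
    rewrite !Cmod_mult, Cmod_R, Rabs_right by (apply Rle_ge, pos_INR).
    assert (P := pow_taylor_bound z h rho n ltac:(lra) Hzh).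
    set (N := INR (n + 1)) in *. set (q := rho ^ n) in *. set (c := Cmod (a (n + 1)%nat)).
    replace (Cmod h ^ 2 / rho * (N * (N * c) * q)) with (c * (N ^ 2 * Cmod h ^ 2 * q / rho))
      by (field; lra).
    apply Rmult_le_compat_l; [apply Cmod_ge_0|].
    apply Rle_div_r; [lra|]. lra.
  - change (Cmod h ^ 2 / rho * K <= eps * Cmod h).
    assert (L : Cmod h * (K + 1) <= eps * rho).
    { apply Rle_div_r; lra. }
    replace (Cmod h ^ 2 / rho * K) with (Cmod h * (Cmod h * K / rho)) by (field; lra).
    rewrite (Rmult_comm eps). apply Rmult_le_compat_l; [assumption|].
    apply Rle_div_l; [lra|]. nra.
Qed.

(** * Maximum modulus and the Schwarz lemma *)

Section Continuity.
Context {U : UniformSpace}.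

Lemma continuous_Cpair (f g : U -> R) (x : U) :
  continuous f x -> continuous g x ->
  continuous (U := C_UniformSpace) (fun y => (f y, g y) : C) x.
Proof.
  intros Hf Hg P [eps HP].
  assert (A := Hf _ (locally_ball (f x) eps)). assert (B := Hg _ (locally_ball (g x) eps)).
  unfold filtermap in *. generalize (filter_and _ _ A B). apply filter_imp.
  intros y [H1 H2]. apply HP. split; assumption.
Qed.

Lemma continuous_Re_comp (f : U -> C) (x : U) :
  continuous (U := C_UniformSpace) f x -> continuous (fun y => Re (f y)) x.
Proof. intros H. apply (continuous_comp f (@fst R R)); [exact H|apply continuous_fst]. Qed.

Lemma continuous_Im_comp (f : U -> C) (x : U) :
  continuous (U := C_UniformSpace) f x -> continuous (fun y => Im (f y)) x.
Proof. intros H. apply (continuous_comp f (@snd R R)); [exact H|apply continuous_snd]. Qed.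

Lemma continuous_Rminus (f g : U -> R) (x : U) :
  continuous f x -> continuous g x -> continuous (fun y => f y - g y) x.
Proof. exact (continuous_minus (V := R_NormedModule) f g x). Qed.

Lemma continuous_Rplus (f g : U -> R) (x : U) :
  continuous f x -> continuous g x -> continuous (fun y => f y + g y) x.
Proof. exact (continuous_plus (V := R_NormedModule) f g x). Qed.

Lemma continuous_Rmult (f g : U -> R) (x : U) :
  continuous f x -> continuous g x -> continuous (fun y => f y * g y) x.
Proof. exact (continuous_mult (K := R_AbsRing) f g x). Qed.

Lemma continuous_Cplus (f g : U -> C) (x : U) :
  continuous (U := C_UniformSpace) f x -> continuous (U := C_UniformSpace) g x ->
  continuous (U := C_UniformSpace) (fun y => f y + g y)%C x.
Proof.
  intros Hf Hg. apply (continuous_Cpair (fun y => Re (f y) + Re (g y)) (fun y => Im (f y) + Im (g y)));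
    apply continuous_Rplus; auto using continuous_Re_comp, continuous_Im_comp.
Qed.

Lemma continuous_Cmult (f g : U -> C) (x : U) :
  continuous (U := C_UniformSpace) f x -> continuous (U := C_UniformSpace) g x ->
  continuous (U := C_UniformSpace) (fun y => f y * g y)%C x.
Proof.
  intros Hf Hg.
  apply (continuous_Cpair (fun y => Re (f y) * Re (g y) - Im (f y) * Im (g y))
    (fun y => Re (f y) * Im (g y) + Im (f y) * Re (g y)));
    [apply continuous_Rminus | apply continuous_Rplus]; apply continuous_Rmult;
    auto using continuous_Re_comp, continuous_Im_comp.
Qed.

End Continuity.

Lemma cderiv_continuous (f : C -> C) (z l : C) :
  cderiv f z l -> continuous (T := C_UniformSpace) (U := C_UniformSpace) f z.
Proof.
  intros H. apply cderiv_eps with (eps := 1) in H; [|lra].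
  destruct H as [d [Hd0 Hd]].
  intros P [eps HP].
  set (K := 1 + Cmod l).
  assert (HK : 0 < K) by (unfold K; assert (T := Cmod_ge_0 l); lra).
  (* [K] is a Lipschitz constant at [z], from the error term with eps = 1. The half is there because
     the balls bound each coordinate separately, and [Cmod] is at most the sum of the two. *)
  assert (Hm : 0 < Rmin d (eps / K) / 2).
  { apply Rdiv_lt_0_compat; [|lra]. apply Rmin_pos; [lra|].
    apply Rdiv_lt_0_compat; [apply cond_pos | exact HK]. }
  exists (mkposreal _ Hm). intros w Hw. change C in w. apply HP.
  destruct Hw as [H1 H2].
  change (Rabs (fst w - fst z) < Rmin d (eps / K) / 2) in H1.
  change (Rabs (snd w - snd z) < Rmin d (eps / K) / 2) in H2.
  assert (M1 := Rmin_l d (eps / K)). assert (M2 := Rmin_r d (eps / K)).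
  assert (Hh : Cmod (w - z)%C < Rmin d (eps / K)).
  { eapply Rle_lt_trans; [apply Cmod_le_sum|]. simpl. unfold Rminus in *. lra. }
  specialize (Hd (w - z)%C ltac:(lra)).
  replace (z + (w - z))%C with w in Hd by ring.
  assert (A : Cmod (f w - f z)%C < eps).
  { assert (T := Cmod_triangle (f w - f z - (w - z) * l) ((w - z) * l)).
    replace (f w - f z - (w - z) * l + (w - z) * l)%C with (f w - f z)%C in T by ring.
    rewrite Cmod_mult in T.
    assert (B : Cmod (w - z) * K < eps) by (apply Rlt_div_r; lra).
    unfold K in B. lra. }
  split.
  - change (Rabs (fst (f w) - fst (f z)) < eps).
    eapply Rle_lt_trans; [apply (Rabs_Re_le (f w - f z)%C)|exact A].
  - change (Rabs (snd (f w) - snd (f z)) < eps).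
    eapply Rle_lt_trans; [apply (Rabs_Im_le (f w - f z)%C)|exact A].
Qed.

(** Holomorphy with a continuous derivative, which allows differentiation under the integral. It
    holds for power series and is closed under sums, products and inverses, so it can be carried to
    any explicit formula in them. *)
Definition C1_disk (f f' : C -> C) : Prop :=
  forall z, disk z -> cderiv f z (f' z) /\
    continuous (T := C_UniformSpace) (U := C_UniformSpace) f' z.

Lemma C1_disk_const (a : C) : C1_disk (fun _ => a) (fun _ => 0%C).
Proof. intros z _. split; [apply cderiv_const | apply continuous_const]. Qed.

Lemma C1_disk_id : C1_disk (fun z => z) (fun _ => 1%C).
Proof. intros z _. split; [apply cderiv_id | apply continuous_const]. Qed.

Lemma C1_disk_psum (a : nat -> C) : tempered a -> C1_disk (psum a) (psum (dcoef a)).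
Proof.
  intros Ha z Hz. split; [now apply cderiv_psum|].
  eapply cderiv_continuous. apply cderiv_psum; [now apply tempered_dcoef | exact Hz].
Qed.

Lemma C1_disk_plus (f f' g g' : C -> C) : C1_disk f f' -> C1_disk g g' ->
  C1_disk (fun z => f z + g z)%C (fun z => f' z + g' z)%C.
Proof.
  intros Hf Hg z Hz. destruct (Hf z Hz) as [F1 F2]. destruct (Hg z Hz) as [G1 G2].
  split; [now apply cderiv_plus | now apply continuous_Cplus].
Qed.

Lemma C1_disk_mult (f f' g g' : C -> C) : C1_disk f f' -> C1_disk g g' ->
  C1_disk (fun z => f z * g z)%C (fun z => f' z * g z + f z * g' z)%C.
Proof.
  intros Hf Hg z Hz. destruct (Hf z Hz) as [F1 F2]. destruct (Hg z Hz) as [G1 G2].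
  split; [now apply cderiv_mult|].
  apply (continuous_Cplus (fun z => f' z * g z)%C (fun z => f z * g' z)%C);
    apply continuous_Cmult; eauto using cderiv_continuous.
Qed.

Lemma C1_disk_inv (f f' : C -> C) : C1_disk f f' -> (forall z, disk z -> f z <> 0) ->
  C1_disk (fun z => / f z)%C (fun z => f' z * - (/ f z * / f z))%C.
Proof.
  intros Hf Hn z Hz. destruct (Hf z Hz) as [F1 F2]. specialize (Hn z Hz).
  assert (A : cderiv (fun z => / f z)%C z (f' z * - (/ f z * / f z))%C).
  { replace (/ f z * / f z)%C with (/ (f z * f z))%C by (field; exact Hn).
    apply (cderiv_comp Cinv f); [now apply cderiv_inv_id | exact F1]. }
  split; [exact A|].
  apply (continuous_Cmult f'); [exact F2|].
  apply cderiv_continuous in A.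
  assert (B := continuous_Cmult _ _ _ A A).
  apply (continuous_Cpair (fun y => - Re (/ f y * / f y)%C) (fun y => - Im (/ f y * / f y)%C));
    apply (continuous_opp (V := R_NormedModule));
    [now apply (continuous_Re_comp (fun y => / f y * / f y)%C)
    |now apply (continuous_Im_comp (fun y => / f y * / f y)%C)].
Qed.

Lemma C1_disk_pow (f f' : C -> C) (n : nat) : C1_disk f f' ->
  exists g', C1_disk (fun z => f z ^ n)%C g'.
Proof.
  intros Hf. induction n as [|n [g' Hg]].
  - exists (fun _ => 0%C). intros z Hz. split.
    + apply (cderiv_const 1%C).
    + apply continuous_const.
  - eexists. exact (C1_disk_mult _ _ _ _ Hf Hg).
Qed.

(** The map 1 / (1 - u) sends the unit disk into a half plane. This serves both for the integral
    kernel and for the derivative of [Phi]. *)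
Lemma Re_inv_1_minus (u : C) : Cmod u < 1 -> / 2 < Re (/ (1 - u))%C.
Proof.
  intros Hu. assert (E := Cmod2_alt u). assert (P := Cmod_ge_0 u).
  destruct u as [x y]. unfold Re, Im in *; simpl in *.
  assert (H : x * x + y * y < 1) by nra.
  assert (Hx : x < 1) by nra.
  apply Rlt_div_r; nra.
Qed.

Definition circle (r t : R) : C := (r * cos t, r * sin t).

Lemma Cmod_circle (r t : R) : 0 <= r -> Cmod (circle r t) = r.
Proof.
  intros Hr. unfold circle, Cmod; cbn [fst snd].
  replace (_ + _) with (r * r * ((sin t)² + (cos t)²)) by (unfold Rsqr; ring).
  rewrite sin2_cos2, Rmult_1_r. now apply sqrt_square.
Qed.

Lemma rderiv_circle (r t : R) : rderiv (circle r) t (Ci * circle r t)%C.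
Proof.
  split; unfold circle, Ci, Re, Im; cbn [fst snd Cmult]; auto_derive; auto; ring.
Qed.

Lemma rderiv_continuous_Re (g : R -> C) (t : R) (d : C) :
  rderiv g t d -> continuous (fun s => Re (g s)) t.
Proof.
  intros [H _]. apply (ex_derive_continuous (fun s => Re (g s))). eexists; exact H.
Qed.

(** The mean of [G (z0 + s (r e^(it) - z0)) / (1 - z0 / (r e^(it)))] over [t] does not depend
    on [s]: its [s]-derivative is the integral of a [t]-derivative. For [C1] functions this
    replaces Cauchy's theorem. *)
Section CauchyBound.
Variables (G G' : C -> C) (z0 c : C) (r M : R).
Hypothesis Hr : Cmod z0 < r < 1.
Hypothesis HG : C1_disk G G'.
Hypothesis HM : forall z, Cmod z = r -> Cmod (G z) <= M.

Let homotopy (s t : R) : C := (z0 + RtoC s * (circle r t - z0))%C.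
Let kern (t : R) : C := (circle r t / (circle r t - z0))%C.
(** The factor [c] and the real part keep all integrals real; in the end [c] is the conjugate of
    [G z0]. *)
Let u (s t : R) : R := Re (c * kern t * G (homotopy s t))%C.
(** The chain rule in s produces [circle r t - z0], which cancels the denominator of [kern]. *)
Let du (s t : R) : R := Re (c * circle r t * G' (homotopy s t))%C.
(** Chosen so that (1 + 2 eta) r = 1. The homotopy then stays in the disk for s slightly outside
    [0, 1], and two-sided s-derivatives exist at both ends. *)
Let eta : R := (/ r - 1) / 2.

Local Lemma r_pos : 0 < r.
Proof. assert (T := Cmod_ge_0 z0). lra. Qed.

Local Lemma eta_pos : 0 < eta.
Proof.
  assert (T := r_pos). unfold eta. assert (1 < / r); [|lra].
  rewrite <- Rinv_1. apply Rinv_lt_contravar; lra.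
Qed.

Local Lemma circle_neq (t : R) : (circle r t - z0)%C <> 0.
Proof.
  apply Cmod_gt_0. assert (T := Cmod_sub_le (circle r t) z0).
  rewrite Cmod_circle in T by (left; apply r_pos). lra.
Qed.

(** The point is (1 - s) z0 + s r e^(it), and |1 - s| + |s| < 1 + 2 eta = 1 / r. *)
Local Lemma homotopy_disk (s t : R) : - eta < s < 1 + eta -> disk (homotopy s t).
Proof.
  intros Hs. unfold homotopy, disk. assert (P := r_pos). assert (P' := eta_pos). assert (Q := Cmod_ge_0 z0).
  replace (z0 + RtoC s * (circle r t - z0))%C with
    (RtoC (1 - s) * z0 + RtoC s * circle r t)%C by (rewrite RtoC_minus; ring).
  assert (T := Cmod_triangle (RtoC (1 - s) * z0) (RtoC s * circle r t)).
  rewrite !Cmod_mult, !Cmod_R, Cmod_circle in T by lra.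
  assert (A : Rabs (1 - s) + Rabs s < 1 + 2 * eta).
  { unfold Rabs; repeat destruct Rcase_abs; lra. }
  assert (B : (1 + 2 * eta) * r = 1) by (unfold eta; field; lra).
  assert (D := Rabs_pos (1 - s)). assert (E := Rabs_pos s).
  assert (F : (Rabs (1 - s) + Rabs s) * r < (1 + 2 * eta) * r) by (apply Rmult_lt_compat_r; lra).
  assert (F2 : Rabs (1 - s) * Cmod z0 <= Rabs (1 - s) * r) by (apply Rmult_le_compat_l; lra).
  lra.
Qed.

Local Lemma is_derive_u (s t : R) : - eta < s < 1 + eta ->
  is_derive (fun x => u x t) s (du s t).
Proof.
  intros Hs. assert (D := homotopy_disk s t Hs). destruct (HG _ D) as [A _].
  assert (B := rderiv_comp G (fun x => homotopy x t) s _ _ A (rderiv_line _ _ _)).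
  apply (rderiv_mult_const_l (c * kern t)%C) in B. destruct B as [B _].
  unfold du. replace (c * circle r t * G' (homotopy s t))%C with
    (c * kern t * (G' (homotopy s t) * (circle r t - z0)))%C; [exact B|].
  unfold kern. field. apply circle_neq.
Qed.

Local Lemma continuous_u (s t : R) : - eta < s < 1 + eta -> continuous (u s) t.
Proof.
  intros Hs. assert (D := homotopy_disk s t Hs). destruct (HG _ D) as [A _].
  assert (L : cderiv (fun w => z0 + RtoC s * (w - z0))%C (circle r t)
    (0 + (0 * (circle r t - z0) + RtoC s * (1 + 0)))%C).
  { apply (cderiv_plus (fun _ => z0) (fun w => RtoC s * (w - z0))%C); [apply cderiv_const|].
    apply (cderiv_mult (fun _ => RtoC s) (fun w => w - z0)%C); [apply cderiv_const|].
    apply (cderiv_plus (fun w => w) (fun _ => - z0)%C); [apply cderiv_id | apply cderiv_const]. }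
  assert (B := cderiv_comp G (fun w => z0 + RtoC s * (w - z0))%C _ _ _ A L).
  assert (K := cderiv_div (fun w => w) (fun w => w - z0)%C _ _ _ (cderiv_id (circle r t))
    (cderiv_plus (fun w => w) (fun _ => - z0)%C _ _ _ (cderiv_id (circle r t)) (cderiv_const (- z0) (circle r t)))
    (circle_neq t)).
  assert (F := cderiv_mult _ _ _ _ _
    (cderiv_mult (fun _ => c) (fun w => w / (w - z0))%C _ _ _ (cderiv_const c (circle r t)) K) B).
  exact (rderiv_continuous_Re _ _ _ (rderiv_comp _ _ _ _ _ F (rderiv_circle r t))).
Qed.

Local Lemma continuous_circle_snd (p : R * R) :
  continuous (U := C_UniformSpace) (fun q : R * R => circle r (snd q)) p.
Proof.
  apply continuous_Cpair; apply continuous_Rmult; try apply continuous_const;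
    [apply (continuous_comp (@snd R R) cos) | apply (continuous_comp (@snd R R) sin)];
    try apply continuous_snd; [apply continuous_cos | apply continuous_sin].
Qed.

Local Lemma continuous_du (s t : R) : - eta < s < 1 + eta ->
  continuous (fun p : R * R => du (fst p) (snd p)) (s, t).
Proof.
  intros Hs. assert (D := homotopy_disk s t Hs). destruct (HG _ D) as [_ A].
  assert (E := continuous_circle_snd (s, t)).
  apply (continuous_Re_comp (fun p : R * R => c * circle r (snd p) * G' (homotopy (fst p) (snd p)))%C).
  apply continuous_Cmult.
  - apply continuous_Cmult; [apply continuous_const | exact E].
  - apply (continuous_comp (fun p : R * R => homotopy (fst p) (snd p)) G'); [|exact A].
    unfold homotopy.
    apply (continuous_Cplus (fun _ => z0)); [apply continuous_const|].
    apply (continuous_Cmult (fun p : R * R => RtoC (fst p))).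
    + apply (continuous_Cpair (@fst R R) (fun _ => 0)); [apply continuous_fst|apply continuous_const].
    + apply (continuous_Cplus _ (fun _ => - z0)%C); [exact E | apply continuous_const].
Qed.

Local Lemma locally_eta (s : R) : - eta < s < 1 + eta ->
  locally s (fun x => - eta < x < 1 + eta).
Proof.
  intros Hs. apply filter_and.
  - apply (open_gt (- eta)). lra.
  - apply (open_lt (1 + eta)). lra.
Qed.

Local Lemma is_derive_circle_mean (s : R) : - eta < s < 1 + eta ->
  is_derive (fun x => RInt (u x) 0 (2 * PI)) s (RInt (du s) 0 (2 * PI)).
Proof.
  intros Hs.
  assert (L := locally_eta s Hs).
  replace (RInt (du s) 0 (2 * PI)) with (RInt (fun t => Derive (fun x => u x t) s) 0 (2 * PI)).
  - apply (is_derive_RInt_param u 0 (2 * PI) s).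
    + generalize L. apply filter_imp. intros x Hx t _. eexists. now apply is_derive_u.
    + intros t _. apply continuity_2d_pt_ext_loc with du.
      * destruct L as [d Hd]. exists d. intros x y Hx _.
        symmetry. apply is_derive_unique, is_derive_u, Hd. exact Hx.
      * apply continuity_2d_pt_filterlim. now apply continuous_du.
    + generalize L. apply filter_imp. intros x Hx.
      apply (ex_RInt_continuous (V := R_CompleteNormedModule)).
      intros t _. now apply continuous_u.
  - apply RInt_ext. intros t _. now apply is_derive_unique, is_derive_u.
Qed.

Local Lemma RInt_du (s : R) : 0 < s < 1 -> RInt (du s) 0 (2 * PI) = 0.
Proof.
  intros Hs. assert (E := eta_pos). assert (Hs' : - eta < s < 1 + eta) by lra.
  assert (Hs0 : RtoC s <> 0) by (intros H; apply RtoC_inj in H; lra).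
  apply is_RInt_unique.
  (* A primitive of [du s] in t. Since the homotopy has t-derivative i s r e^(it), dividing by i s
     is required, whence s > 0; by periodicity [A] takes the same value at both ends. *)
  set (A := fun t => Re (- Ci * c / RtoC s * G (homotopy s t))%C).
  replace 0 with (minus (A (2 * PI)) (A 0)) at 2.
  2:{ unfold A. replace (homotopy s (2 * PI)) with (homotopy s 0).
      - apply (minus_eq_zero (G := R_AbelianGroup)).
      - unfold homotopy, circle. now rewrite cos_2PI, sin_2PI, cos_0, sin_0. }
  apply (is_RInt_derive (V := R_CompleteNormedModule)).
  - intros t _. assert (D := homotopy_disk s t Hs'). destruct (HG _ D) as [B _].
    assert (L : rderiv (homotopy s) t (RtoC s * (Ci * circle r t))%C).
    { split; unfold homotopy, circle, Ci, Re, Im; simpl; auto_derive; auto; ring. }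
    assert (K := rderiv_comp G (homotopy s) t _ _ B L).
    apply (rderiv_mult_const_l (- Ci * c / RtoC s)%C) in K. destruct K as [K _].
    unfold A, du.
    replace (c * circle r t * G' (homotopy s t))%C with
      (- Ci * c / RtoC s * (G' (homotopy s t) * (RtoC s * (Ci * circle r t))))%C; [exact K|].
    transitivity (- (Ci * Ci) * (c * circle r t * G' (homotopy s t)))%C; [field; exact Hs0|].
    replace (Ci * Ci)%C with (- (1))%C by (apply injective_projections; simpl; ring). ring.
  - intros t _.
    apply (continuous_comp (fun t => (s, t)) (fun p : R * R => du (fst p) (snd p))).
    + apply (continuous_Cpair (fun _ => s) (fun t => t)); [apply continuous_const|apply continuous_id].
    + now apply continuous_du.
Qed.

(** The mean value theorem evaluates the s-derivative only at an interior point, so the division by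
    s in [RInt_du] does no harm. *)
Local Lemma circle_mean_const : RInt (u 1) 0 (2 * PI) = RInt (u 0) 0 (2 * PI).
Proof.
  assert (E := eta_pos).
  destruct (MVT_cor2 (fun x => RInt (u x) 0 (2 * PI)) (fun s => RInt (du s) 0 (2 * PI)) 0 1)
    as [x [Hx Hx01]]; [lra| |].
  - intros s Hs. apply is_derive_Reals, is_derive_circle_mean. lra.
  - rewrite RInt_du in Hx by exact Hx01. lra.
Qed.

Local Lemma Cmod_kern (t : R) : Cmod (kern t) <= r / (r - Cmod z0).
Proof.
  assert (P := r_pos). unfold kern.
  rewrite Cmod_div, Cmod_circle by (apply circle_neq || lra).
  apply Rmult_le_compat_l; [lra|]. apply Rinv_le_contravar; [lra|].
  assert (T := Cmod_sub_le (circle r t) z0). rewrite Cmod_circle in T by lra. lra.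
Qed.

(** The kernel equals 1 / (1 - z0 / (r e^(it))). The lower bound 1/2 stands in for its exact mean 1,
    at the price of the factor 2 in [mean_value_bound]. *)
Local Lemma Re_kern (t : R) : / 2 < Re (kern t).
Proof.
  assert (P := r_pos).
  assert (N : circle r t <> 0) by (apply Cmod_gt_0; rewrite Cmod_circle; lra).
  unfold kern. replace (circle r t / (circle r t - z0))%C with (/ (1 - z0 / circle r t))%C.
  - apply Re_inv_1_minus. rewrite Cmod_div, Cmod_circle by (assumption || lra).
    apply Rlt_div_l; lra.
  - field. split; [apply circle_neq | assumption].
Qed.

Local Lemma ex_RInt_u (s : R) : - eta < s < 1 + eta -> ex_RInt (u s) 0 (2 * PI).
Proof.
  intros Hs. apply (ex_RInt_continuous (V := R_CompleteNormedModule)).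
  intros t _. now apply continuous_u.
Qed.

(** With this [c] the integrand at s = 0 is |G z0|^2 Re kern >= |G z0|^2 / 2, while at s = 1 it is
    at most |G z0| M r / (r - |z0|). The two integrals are equal, and one factor |G z0| cancels. *)
Lemma mean_value_bound : c = Cconj (G z0) ->
  Cmod (G z0) <= 2 * r / (r - Cmod z0) * M.
Proof.
  intros Hc. assert (P := r_pos). assert (E := eta_pos). assert (HPI := PI_RGT_0).
  set (K := r / (r - Cmod z0)).
  assert (HG0 := Cmod_ge_0 (G z0)).
  assert (A : RInt (fun _ => Cmod (G z0) ^ 2 * / 2) 0 (2 * PI) <= RInt (u 0) 0 (2 * PI)).
  { apply RInt_le; [lra | apply ex_RInt_const | apply ex_RInt_u; lra |].
    intros t _. unfold u, homotopy.
    replace (z0 + RtoC 0 * (circle r t - z0))%C with z0 by ring.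
    replace (Re (c * kern t * G z0)%C) with (Cmod (G z0) ^ 2 * Re (kern t)).
    - apply Rmult_le_compat_l; [apply pow2_ge_0|]. left. apply Re_kern.
    - rewrite Cmod2_alt, Hc. unfold Re, Im; simpl. ring. }
  assert (B : RInt (u 1) 0 (2 * PI) <= RInt (fun _ => Cmod (G z0) * K * M) 0 (2 * PI)).
  { apply RInt_le; [lra | apply ex_RInt_u; lra | apply ex_RInt_const |].
    intros t _. unfold u, homotopy.
    replace (z0 + RtoC 1 * (circle r t - z0))%C with (circle r t) by ring.
    eapply Rle_trans; [apply Re_le_Cmod|]. rewrite !Cmod_mult, Hc, Cmod_conj.
    apply Rmult_le_compat; try apply Rmult_le_pos; try apply Cmod_ge_0.
    - apply Rmult_le_compat_l; [assumption | apply Cmod_kern].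
    - apply HM, Cmod_circle. lra. }
  rewrite circle_mean_const in B. assert (D := Rle_trans _ _ _ A B).
  rewrite !RInt_const in D.
  change ((2 * PI - 0) * (Cmod (G z0) ^ 2 * / 2) <= (2 * PI - 0) * (Cmod (G z0) * K * M)) in D.
  apply Rmult_le_reg_l in D; [|lra].
  replace (2 * r / (r - Cmod z0) * M) with (2 * (K * M)) by (unfold K, Rdiv; ring).
  destruct HG0 as [H0|H0].
  - apply Rmult_le_reg_l with (Cmod (G z0)); [exact H0|]. lra.
  - rewrite <- H0. apply Rmult_le_pos; [lra|]. apply Rmult_le_pos.
    + left. apply Rdiv_lt_0_compat; lra.
    + assert (Q := HM (circle r 0) (Cmod_circle r 0 ltac:(lra))).
      assert (Q2 := Cmod_ge_0 (G (circle r 0))). lra.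
Qed.

End CauchyBound.

Lemma bounded_powers_le_1 (x K : R) : (forall n, x ^ n <= K) -> x <= 1.
Proof.
  intros H. destruct (Rle_dec x 1) as [|N]; [assumption|exfalso].
  assert (Hx : 0 < x - 1) by lra.
  destruct (INR_unbounded (K / (x - 1))) as [n Hn].
  assert (P := poly n (x - 1) Hx). replace (1 + (x - 1)) with x in P by ring.
  specialize (H n). apply Rlt_div_l in Hn; lra.
Qed.

(** The bound of [mean_value_bound] applied to all powers of [g] loses its constant. *)
Lemma maximum_modulus (g g' : C -> C) (z0 : C) (r M : R) :
  Cmod z0 < r < 1 -> 0 < M -> C1_disk g g' ->
  (forall z, Cmod z = r -> Cmod (g z) <= M) -> Cmod (g z0) <= M.
Proof.
  intros Hr HM Hg Hb.
  assert (T := Cmod_ge_0 z0).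
  assert (H : Cmod (g z0) / M <= 1); [|apply Rle_div_l in H; lra].
  apply bounded_powers_le_1 with (2 * r / (r - Cmod z0)). intros n.
  destruct (C1_disk_pow g g' n Hg) as [h Hh].
  assert (B : Cmod (g z0 ^ n)%C <= 2 * r / (r - Cmod z0) * M ^ n).
  { apply (mean_value_bound (fun z => g z ^ n)%C h z0 (Cconj (g z0 ^ n)) r (M ^ n)); auto.
    intros z Hz. rewrite Cmod_pow. apply pow_incr. split; [apply Cmod_ge_0 | auto]. }
  rewrite Cmod_pow in B. unfold Rdiv at 1. rewrite Rpow_mult_distr, pow_inv.
  apply Rle_div_l; [now apply pow_lt | exact B].
Qed.

(** Stated for a product z g with [g] itself C1, so the quotient by z is given in advance. On |z| =
    r one has |g| <= 1 / r; the maximum modulus carries this inside, and r tends to 1. *)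
Lemma schwarz (g g' : C -> C) (z : C) : C1_disk g g' ->
  (forall z, disk z -> Cmod (z * g z)%C <= 1) -> disk z -> Cmod (z * g z)%C <= Cmod z.
Proof.
  intros Hg Hb Hz. unfold disk in *.
  assert (T := Cmod_ge_0 z).
  assert (H : Cmod (g z) <= 1).
  { apply Rle_plus_epsilon. intros eps He.
    (* The first entry puts [z] inside the circle, the second makes 1 / r <= 1 + eps. *)
    set (r := Rmax ((1 + Cmod z) / 2) (/ (1 + eps))).
    assert (R1 : (1 + Cmod z) / 2 <= r) by apply Rmax_l.
    assert (R2 : / (1 + eps) <= r) by apply Rmax_r.
    assert (R3 : r < 1).
    { apply Rmax_lub_lt; [lra|]. rewrite <- Rinv_1 at 2. apply Rinv_lt_contravar; lra. }
    apply (maximum_modulus g g' z r); auto; try lra.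
    intros w Hw. specialize (Hb w). rewrite Cmod_mult, Hw in Hb.
    specialize (Hb R3).
    apply Rle_trans with (/ r).
    - apply Rmult_le_reg_l with r; [lra|]. rewrite Rinv_r; lra.
    - rewrite <- (Rinv_inv (1 + eps)). apply Rinv_le_contravar; [|exact R2].
      apply Rinv_0_lt_compat; lra. }
  rewrite Cmod_mult. rewrite <- (Rmult_1_r (Cmod z)) at 2.
  now apply Rmult_le_compat_l.
Qed.

(** * Starlike functions *)

Lemma disk_0 : disk 0.
Proof. unfold disk. rewrite Cmod_0. lra. Qed.

Lemma analytic_of_cderiv (f f' : C -> C) :
  (forall z, disk z -> cderiv f z (f' z)) -> analytic f.
Proof. intros H z Hz. exists (f' z). now apply H. Qed.

Lemma Cis_series_0 (u : nat -> C) (l : C) :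
  Cis_series u l -> (forall n, u n = 0) -> l = 0.
Proof.
  intros H H0. apply Cmod_eq_0. apply Rle_antisym; [|apply Cmod_ge_0].
  apply (Cmod_is_series_le u l (fun _ => 0) 0 H).
  - change (is_lim_seq (sum_n (fun _ : nat => 0)) 0).
    apply is_lim_seq_ext with (fun _ => 0); [|apply is_lim_seq_const].
    intros n. symmetry. rewrite sum_n_const. apply Rmult_0_r.
  - intros n. rewrite H0, Cmod_0. lra.
Qed.

(** The series of f z - z starts at exponent 2, so dividing by z^2 leaves an ordinary power series.
    At 0 every term of the original series vanishes, which gives f 0 = 0 and extends the formula
    there. *)
Lemma classA_psum (f : C -> C) : classA f ->
  exists b, tempered b /\ forall z, disk z -> f z = (z + z * z * psum b z)%C.
Proof.
  intros [_ [a Ha]]. set (b := fun n => a (n + 2)%nat).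
  assert (Hb : forall z, disk z -> z <> 0 ->
    Cis_series (fun n => b n * z ^ n)%C (/ (z * z) * (f z - z))%C).
  { intros z Hz Hn. specialize (Ha z Hz).
    apply (is_series_scal (K := C_AbsRing) (V := C_NormedModule) (/ (z * z))%C) in Ha.
    eapply is_series_ext; [|exact Ha]. intros n.
    change (/ (z * z) * (a (n + 2)%nat * z ^ (n + 2)) = b n * z ^ n)%C.
    unfold b. rewrite Cpow_add_r. simpl (z ^ 2)%C. field. exact Hn. }
  exists b. split.
  - apply tempered_of_convergent. intros z Hz Hn. eexists. now apply Hb.
  - intros z Hz. destruct (Ceq_dec z 0) as [E|E].
    + subst z. assert (F : (f 0 - 0 = 0)%C).
      { apply (Cis_series_0 _ _ (Ha 0%C Hz)). intros n.
        rewrite Nat.add_comm. simpl. ring. }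
      replace (f 0) with (f 0 - 0)%C by ring. rewrite F. ring.
    + rewrite (psum_unique b z _ (Hb z Hz E)). field. exact E.
Qed.

Lemma cderiv_classA (f : C -> C) (b : nat -> C) (z : C) : tempered b ->
  (forall z, disk z -> f z = (z + z * z * psum b z)%C) -> disk z ->
  cderiv f z (1 + RtoC 2 * z * psum b z + z * z * psum (dcoef b) z)%C.
Proof.
  intros Hb Hf Hz.
  apply (cderiv_ext_disk (fun z => z + z * z * psum b z)%C); [exact Hz | now intros; symmetry; auto |].
  replace (1 + RtoC 2 * z * psum b z + z * z * psum (dcoef b) z)%C with
    (1 + ((1 * z + z * 1) * psum b z + z * z * psum (dcoef b) z))%C by ring.
  apply (cderiv_plus (fun z => z)); [apply cderiv_id|].
  apply (cderiv_mult (fun z => z * z)%C); [|now apply cderiv_psum].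
  apply (cderiv_mult (fun z => z) (fun z => z)); apply cderiv_id.
Qed.

Lemma C_derive_cderiv (f : C -> C) (z l : C) : cderiv f z l -> C_derive f z = l.
Proof. apply is_C_derive_unique. Qed.

(** Writing [f z = z + z^2 S z], the relation [z f'/f = (1 + (1 - 2 alpha) w)/(1 - w)]
    solves to [w z = z (S z + z S' z) / D z] with [D] nowhere zero; so [w z / z] is
    explicitly C1 on the whole disk and the Schwarz lemma applies without
    removing a singularity at [0]. *)
Lemma starlike_order_schwarz (alpha : R) (f : C -> C) :
  alpha < 1 -> starlike_order alpha f ->
  exists w, analytic w /\ w 0 = 0 /\
    (forall z, disk z -> Cmod (w z) <= Cmod z) /\
    forall z, disk z -> zlogder f z = ((1 + RtoC (1 - 2 * alpha) * w z) / (1 - w z))%C.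
Proof.
  intros Hal [[HA HU] [w [W1 [W2 [W3 W4]]]]].
  exists w. repeat split; try assumption.
  destruct (classA_psum f HA) as [b [Hb Hf]].
  set (beta := RtoC (1 - 2 * alpha)) in *.
  assert (Hbeta : (1 + beta)%C <> 0).
  { unfold beta. rewrite <- RtoC_plus. intros E. apply RtoC_inj in E. lra. }
  set (S := psum b) in *. set (T := psum (dcoef b)).
  (* [D] is f' + beta f / z: solving z f' / f = (1 + beta w) / (1 - w) gives w = (f' - f / z) / (f'
     + beta f / z), and the numerator is z (S + z T). *)
  set (D := fun z => (1 + beta + ((RtoC 2 + beta) * (z * S z) + z * z * T z))%C).
  assert (f0 : f 0 = 0) by (rewrite Hf by apply disk_0; ring).
  (* 1 + z S is f z / z; a zero away from the origin would contradict univalence, as f 0 = 0. *)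
  assert (HB : forall z, disk z -> z <> 0 -> (1 + z * S z)%C <> 0).
  { intros z Hz Hn E. apply Hn, HU; [exact Hz | apply disk_0|].
    rewrite f0, Hf by exact Hz. replace (z + z * z * S z)%C with (z * (1 + z * S z))%C by ring.
    rewrite E. ring. }
  assert (HW : forall z, disk z -> (1 - w z)%C <> 0).
  { intros z Hz E. specialize (W2 z Hz). unfold disk in W2.
    assert (E2 : w z = 1) by (replace (w z) with (1 - (1 - w z))%C by ring; rewrite E; ring).
    rewrite E2, Cmod_1 in W2. lra. }
  assert (Key : forall z, disk z -> (z * (S z + z * T z) = w z * D z)%C).
  { intros z Hz. destruct (Ceq_dec z 0) as [E|E]; [subst z; rewrite W3; ring|].
    specialize (W4 z Hz). unfold zlogder in W4. destruct (Ceq_dec z 0) as [|_]; [contradiction|].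
    rewrite (C_derive_cderiv _ _ _ (cderiv_classA f b z Hb Hf Hz)), Hf in W4 by exact Hz.
    fold S T in W4. specialize (HB z Hz E). specialize (HW z Hz).
    set (A := (1 + RtoC 2 * z * S z + z * z * T z)%C) in W4.
    assert (Q : (A * (1 - w z) = (1 + beta * w z) * (1 + z * S z))%C).
    { replace A with (z * A / (z + z * z * S z) * (1 + z * S z))%C.
      - rewrite W4. field. exact HW.
      - field. replace (z + z * z * S z)%C with (z * (1 + z * S z))%C by ring.
        now apply Cmult_neq_0. }
    assert (Q2 : (A - (1 + z * S z) = w z * (A + beta * (1 + z * S z)))%C).
    { replace (A - (1 + z * S z))%C with (A * (1 - w z) + A * w z - (1 + z * S z))%C by ring.
      rewrite Q. ring. }
    unfold D. transitivity (A - (1 + z * S z))%C; [unfold A; ring|].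
    rewrite Q2. unfold A. ring. }
  assert (HD : forall z, disk z -> D z <> 0).
  { intros z Hz E. destruct (Ceq_dec z 0) as [Z|Z].
    - apply Hbeta. rewrite <- E. unfold D. rewrite Z. ring.
    - assert (K := Key z Hz). rewrite E, Cmult_0_r in K.
      (* At a zero of [D], [Key] makes z (S + z T) vanish as well, and the difference of the two is
         (1 + beta) f z / z. *)
      assert (F : ((1 + beta) * (1 + z * S z) = 0)%C).
      { transitivity (D z - z * (S z + z * T z))%C; [unfold D; ring|]. rewrite E, K. ring. }
      revert F. apply Cmult_neq_0; [exact Hbeta | now apply HB]. }
  assert (CS := C1_disk_psum b Hb). fold S T in CS.
  assert (CT := C1_disk_psum _ (tempered_dcoef b Hb)). fold T in CT.
  assert (CI := C1_disk_id).
  assert (CH := C1_disk_plus _ _ _ _ CS (C1_disk_mult _ _ _ _ CI CT)).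
  assert (CD := C1_disk_plus _ _ _ _ (C1_disk_const (1 + beta)%C)
    (C1_disk_plus _ _ _ _
      (C1_disk_mult _ _ _ _ (C1_disk_const (RtoC 2 + beta)%C) (C1_disk_mult _ _ _ _ CI CS))
      (C1_disk_mult _ _ _ _ (C1_disk_mult _ _ _ _ CI CI) CT))).
  assert (Cg := C1_disk_mult _ _ _ _ CH (C1_disk_inv _ _ CD HD)).
  assert (Wg : forall z, disk z -> w z = (z * ((S z + z * T z) * / D z))%C).
  { intros z Hz. replace (z * ((S z + z * T z) * / D z))%C with (z * (S z + z * T z) * / D z)%C by ring.
    rewrite Key by exact Hz. field. now apply HD. }
  intros z Hz. rewrite Wg by exact Hz.
  refine (schwarz _ _ z Cg _ Hz).
  intros x Hx. assert (L := W2 x Hx). rewrite Wg in L by exact Hx. left. exact L.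
Qed.

(** * The inverse of frakB near 1 *)

Lemma Csqrt_sqr (z : C) : z <> 0 -> (Csqrt z * Csqrt z)%C = z.
Proof.
  intros Hz. unfold Csqrt.
  transitivity (RtoC (sqrt (Cmod z) * sqrt (Cmod z)) * (Cexp (Ci * RtoC (Carg z / 2)) *
    Cexp (Ci * RtoC (Carg z / 2))))%C; [rewrite RtoC_mult; ring|].
  rewrite sqrt_sqrt by apply Cmod_ge_0. rewrite <- Cexp_plus.
  etransitivity; [|exact (Cmod_Carg z Hz)].
  unfold Cexp, Ci, Re, Im; cbn [fst snd Cmult Cplus RtoC].
  replace (0 * (Carg z / 2) - 1 * 0 + (0 * (Carg z / 2) - 1 * 0)) with 0 by ring.
  replace (0 * 0 + 1 * (Carg z / 2) + (0 * 0 + 1 * (Carg z / 2))) with (Carg z) by field.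
  rewrite exp_0. apply injective_projections; unfold Cmult, RtoC; cbn [fst snd]; ring.
Qed.

Lemma Re_Csqrt_ge_0 (z : C) : 0 <= Re (Csqrt z).
Proof.
  unfold Csqrt, Cexp, Ci, Re, Im; cbn [fst snd Cmult RtoC].
  replace (0 * (Carg z / 2) - 1 * 0) with 0 by ring.
  replace (0 * 0 + 1 * (Carg z / 2)) with (Carg z / 2) by ring.
  rewrite exp_0. assert (B := Carg_bound z).
  assert (0 <= cos (Carg z / 2)) by (apply cos_ge_0; lra).
  assert (P := sqrt_pos (Cmod z)). nra.
Qed.

(** The two square roots of w^2 are w and -w, and [Csqrt] has nonnegative real part, which excludes
    -w. *)
Lemma Csqrt_of_sqr (w : C) : 0 < Re w -> Csqrt (w * w) = w.
Proof.
  intros Hw.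
  assert (Hn : w <> 0) by (intros E; rewrite E in Hw; simpl in Hw; lra).
  assert (S := Csqrt_sqr (w * w)%C ltac:(now apply Cmult_neq_0)).
  assert (P := Re_Csqrt_ge_0 (w * w)%C).
  set (s := Csqrt (w * w)) in *.
  assert (E : ((s - w) * (s + w) = 0)%C).
  { transitivity (s * s - w * w)%C; [ring|]. rewrite S. ring. }
  destruct (Ceq_dec (s - w)%C 0) as [H|H].
  - replace s with (s - w + w)%C by ring. rewrite H. ring.
  - exfalso. revert E. apply Cmult_neq_0; [exact H|].
    intros E. apply (f_equal Re) in E. unfold Re in *; simpl in *. lra.
Qed.

(** Makes [frakB w] a function of e^(2w) alone, written as [Cexp w * Cexp w], so that equations in
    [frakB w] become rational in e^(2w). *)
Lemma one_plus_Ctanh (w : C) : (Cexp w * Cexp w + 1)%C <> 0 ->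
  (1 + Ctanh w = RtoC 2 * (Cexp w * Cexp w) / (Cexp w * Cexp w + 1))%C.
Proof.
  intros H. unfold Ctanh. rewrite Cexp_opp. assert (E := Cexp_neq_0 w).
  field. now split.
Qed.

Lemma Cln_1 : Cln 1 = 0.
Proof.
  unfold RtoC. rewrite Cln_half_plane by lra.
  replace (1 * 1 + 0 * 0) with 1 by ring. replace (0 / 1) with 0 by field.
  rewrite ln_1, atan_0. f_equal. field.
Qed.

(** The local inverse of [frakB] at [1], i.e. [frakB (Blog t) = 1 + t]. *)
Definition Blog (t : C) : C := (Cln (1 + t) - RtoC (/ 2) * Cln (1 - RtoC 2 * t - t * t))%C.

Lemma Blog_0 : Blog 0 = 0.
Proof.
  unfold Blog. replace (1 + 0)%C with (RtoC 1) by ring.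
  replace (1 - RtoC 2 * 0 - 0 * 0)%C with (RtoC 1) by ring.
  rewrite Cln_1. ring.
Qed.

Section Blog.
Variable d : R.
Hypothesis Hd : 0 < d.
Hypothesis Hd2 : 2 * d + d * d < 1.

Lemma Blog_Re_1 (t : C) : Cmod t <= d -> 0 < Re (1 + t)%C.
Proof.
  intros Ht. assert (T := Rabs_Re_le t). apply Rabs_le_between in T.
  unfold Re; simpl. nra.
Qed.

(** The condition on [d] is what makes |2t + t^2| < 1, so the second logarithm in [Blog] stays in
    the right half plane. *)
Lemma Blog_Re_2 (t : C) : Cmod t <= d -> 0 < Re (1 - RtoC 2 * t - t * t)%C.
Proof.
  intros Ht. set (v := (RtoC 2 * t + t * t)%C).
  replace (1 - RtoC 2 * t - t * t)%C with (1 - v)%C by (unfold v; ring).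
  assert (T := Cmod_triangle (RtoC 2 * t) (t * t)). fold v in T.
  rewrite !Cmod_mult, Cmod_R, Rabs_right in T by lra.
  assert (U := Re_le_Cmod v). assert (Z := Cmod_ge_0 t).
  unfold Re in *; simpl in *. nra.
Qed.

Lemma neq_0_of_Re (z : C) : 0 < Re z -> z <> 0.
Proof. intros H E. rewrite E in H. simpl in H. lra. Qed.

(** The derivative is 1 / (1 + t) + (1 + t) / (1 - 2t - t^2), and the numerators combine to the
    constant 2 because (1 + t)^2 + (1 - 2t - t^2) = 2. *)
Lemma cderiv_Blog (t : C) : Cmod t <= d ->
  cderiv Blog t (RtoC 2 / ((1 + t) * (1 - RtoC 2 * t - t * t)))%C.
Proof.
  intros Ht. assert (R1 := Blog_Re_1 t Ht). assert (R2 := Blog_Re_2 t Ht).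
  assert (N1 := neq_0_of_Re _ R1). assert (N2 := neq_0_of_Re _ R2).
  assert (L1 : cderiv (fun t => 1 + t)%C t (0 + 1)%C).
  { apply (cderiv_plus (fun _ => 1%C) (fun t => t)); [apply cderiv_const | apply cderiv_id]. }
  assert (L2 : cderiv (fun t => 1 - RtoC 2 * t - t * t)%C t
    (0 + (0 * t + - RtoC 2 * 1) + ((0 * t + - (1) * 1) * t + (- (1) * t) * 1))%C).
  { apply (cderiv_ext (fun t => 1 + - RtoC 2 * t + - (1) * t * t)%C); [intros; ring|].
    apply (cderiv_plus (fun t => 1 + - RtoC 2 * t)%C (fun t => - (1) * t * t)%C).
    - apply (cderiv_plus (fun _ => 1%C) (fun t => - RtoC 2 * t)%C); [apply cderiv_const|].
      apply (cderiv_mult (fun _ => - RtoC 2)%C (fun t => t)); [apply cderiv_const|apply cderiv_id].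
    - apply (cderiv_mult (fun t => - (1) * t)%C (fun t => t)); [|apply cderiv_id].
      apply (cderiv_mult (fun _ => - (1))%C (fun t => t)); [apply cderiv_const|apply cderiv_id]. }
  assert (A := cderiv_comp Cln (fun t => 1 + t)%C _ _ _ (cderiv_Cln _ R1) L1).
  assert (B := cderiv_comp Cln (fun t => 1 - RtoC 2 * t - t * t)%C _ _ _ (cderiv_Cln _ R2) L2).
  assert (K := cderiv_plus _ _ _ _ _ A
    (cderiv_mult _ _ _ _ _ (cderiv_const (- RtoC (/ 2))%C t) B)).
  cbn beta in K.
  eapply cderiv_ext; [|replace (RtoC 2 / ((1 + t) * (1 - RtoC 2 * t - t * t)))%C with
   ((0 + 1) * / (1 + t) + (0 * Cln (1 - RtoC 2 * t - t * t) + - RtoC (/ 2) *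
    ((0 + (0 * t + - RtoC 2 * 1) + ((0 * t + - (1) * 1) * t + (- (1) * t) * 1)) *
      / (1 - RtoC 2 * t - t * t))))%C; [exact K|]].
  - intros x. unfold Blog. ring.
  - rewrite RtoC_inv by lra. field. repeat split; try assumption.
Qed.

Lemma Blog_den_pos (x : R) : 0 <= x <= d -> 0 < 1 - 2 * x - x * x.
Proof. intros Hx. nra. Qed.

Lemma Cmod_Blog_le (t : C) : Cmod t <= d ->
  Cmod (Blog t) <= ln (1 + Cmod t) - ln (1 - 2 * Cmod t - Cmod t * Cmod t) / 2.
Proof.
  intros Ht. set (m := Cmod t). assert (Hm : 0 <= m) by apply Cmod_ge_0.
  set (b := fun s => ln (1 + s * m) - ln (1 - 2 * (s * m) - (s * m) * (s * m)) / 2).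
  assert (Z := Blog_0).
  assert (M := mean_value_Cmod (fun s => Blog (0 + RtoC s * t)%C)
    (fun s => (RtoC 2 / ((1 + RtoC s * t) * (1 - RtoC 2 * (RtoC s * t) - (RtoC s * t) * (RtoC s * t)))) * t)%C
    b (fun s => 2 / ((1 + s * m) * (1 - 2 * (s * m) - (s * m) * (s * m))) * m)).
  cbn beta in M. unfold b in M.
  replace (0 + RtoC 1 * t)%C with t in M by ring.
  replace (0 + RtoC 0 * t)%C with (RtoC 0) in M by ring.
  rewrite Z in M. replace (Blog t - 0)%C with (Blog t) in M by ring.
  rewrite !Rmult_1_l, !Rmult_0_l in M.
  replace (1 - 2 * 0 - 0) with 1 in M by ring.
  rewrite Rplus_0_r, ln_1 in M.
  eapply Rle_trans; [apply M|lra].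
  intros s Hs.
  assert (Hsm : 0 <= s * m <= m) by nra.
  assert (P := Blog_den_pos (s * m) ltac:(unfold m in *; lra)).
  assert (Hst : Cmod (RtoC s * t) = s * m) by (rewrite Cmod_mult, Cmod_R, Rabs_right; unfold m; lra).
  split; [|split].
  - apply (rderiv_comp Blog (fun s => 0 + RtoC s * t)%C); [|apply rderiv_line].
    replace (0 + RtoC s * t)%C with (RtoC s * t)%C by ring.
    apply cderiv_Blog. rewrite Hst. unfold m in *; lra.
  - set (x := m) in *. clearbody x. auto_derive; [repeat split; nra|]. field. split; nra.
  - set (T := (RtoC s * t)%C) in *. set (x := s * m) in *.
    rewrite Cmod_mult. fold m. apply Rmult_le_compat_r; [exact Hm|].
    assert (R1 := Blog_Re_1 T ltac:(unfold m in *; lra)).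
    assert (R2 := Blog_Re_2 T ltac:(unfold m in *; lra)).
    assert (N1 := neq_0_of_Re _ R1). assert (N2 := neq_0_of_Re _ R2).
    rewrite Cmod_div by now apply Cmult_neq_0.
    rewrite Cmod_R, Rabs_right by lra.
    apply Rmult_le_compat_l; [lra|]. apply Rinv_le_contravar.
    + apply Rmult_lt_0_compat; lra.
    (* The denominator is 1 - T - 3 T^2 - T^3. All its nonconstant coefficients are negative, so its
       modulus is at least its value at |T|; this is the form in which the positivity of the Taylor
       coefficients is used. *)
    + replace ((1 + T) * (1 - RtoC 2 * T - T * T))%C with
        (1 - (T + (RtoC 3 * (T * T) + T * (T * T))))%C.
      * assert (A := Cmod_sub_le 1 (T + (RtoC 3 * (T * T) + T * (T * T)))%C).
        assert (B := Cmod_triangle T (RtoC 3 * (T * T) + T * (T * T))%C).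
        assert (D := Cmod_triangle (RtoC 3 * (T * T)) (T * (T * T))%C).
        rewrite !Cmod_mult, Cmod_R, Rabs_right in D by lra. rewrite Cmod_1 in A.
        rewrite Hst in *. nra.
      * transitivity (1 - T - RtoC (1 + 2) * (T * T) - T * (T * T))%C;
          [|rewrite RtoC_plus; ring].
        replace (1 + 2) with 3 by ring. ring.
Qed.

(** Here e^(2 Blog t) = (1 + t)^2 / (1 - 2t - t^2), and adding 1 gives 2 / (1 - 2t - t^2). Hence 1 +
    tanh (Blog t) = (1 + t)^2, whose principal root is 1 + t by positivity of the real part. *)
Lemma frakB_Blog (t : C) : Cmod t <= d -> frakB (Blog t) = (1 + t)%C.
Proof.
  intros Ht. assert (R1 := Blog_Re_1 t Ht). assert (R2 := Blog_Re_2 t Ht).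
  assert (N1 := neq_0_of_Re _ R1). assert (N2 := neq_0_of_Re _ R2).
  assert (E : (Cexp (Blog t) * Cexp (Blog t) = (1 + t) * (1 + t) / (1 - RtoC 2 * t - t * t))%C).
  { rewrite <- Cexp_plus. unfold Blog.
    replace (Cln (1 + t) - RtoC (/ 2) * Cln (1 - RtoC 2 * t - t * t) +
      (Cln (1 + t) - RtoC (/ 2) * Cln (1 - RtoC 2 * t - t * t)))%C with
      (Cln (1 + t) + Cln (1 + t) + - (RtoC (2 * / 2) * Cln (1 - RtoC 2 * t - t * t)))%C
      by (rewrite RtoC_mult; ring).
    rewrite Rinv_r by lra. rewrite Cmult_1_l, !Cexp_plus, Cexp_opp, !Cexp_Cln by assumption.
    reflexivity. }
  assert (N3 : ((1 + t) * (1 + t) + (1 - RtoC 2 * t - t * t) = RtoC 2)%C).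
  { replace (RtoC 2) with (RtoC (1 + 1)) by (f_equal; ring). rewrite RtoC_plus. ring. }
  assert (N4 : (Cexp (Blog t) * Cexp (Blog t) + 1 = RtoC 2 / (1 - RtoC 2 * t - t * t))%C).
  { rewrite E, <- N3 at 1. field. exact N2. }
  assert (N2' : RtoC 2 <> 0) by (intros K; apply RtoC_inj in K; lra).
  unfold frakB. rewrite one_plus_Ctanh.
  - rewrite N4, E. rewrite <- (Csqrt_of_sqr (1 + t)) at 3 by exact R1.
    f_equal. field. assumption.
  - rewrite N4. intros K. apply N2'.
    replace (RtoC 2) with (RtoC 2 / (1 - RtoC 2 * t - t * t) * (1 - RtoC 2 * t - t * t))%C
      by (field; assumption).
    rewrite K. ring.
Qed.

End Blog.

(** * The functions z / (1 - z)^c *)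

(** Taylor coefficients of [(1 - z)^(-c)]. *)
Fixpoint bcoef (c : R) (n : nat) : R :=
  match n with
  | 0%nat => 1
  | S m => bcoef c m * (c + INR m) / INR (S m)
  end.

Lemma cderiv_one_minus (z : C) : cderiv (fun w => 1 - w)%C z (- (1))%C.
Proof.
  apply (cderiv_ext (fun w => 1 + - (1) * w)%C); [intros; ring|].
  assert (A := cderiv_plus (fun _ => 1%C) (fun w => - (1) * w)%C z _ _ (cderiv_const _ _)
    (cderiv_mult (fun _ => - (1))%C (fun w => w) z _ _ (cderiv_const _ _) (cderiv_id _))).
  cbn beta in A. replace (0 + (0 * z + - (1) * 1))%C with (- (1))%C in A by ring. exact A.
Qed.

Lemma Re_one_minus (z : C) : disk z -> 0 < Re (1 - z)%C.
Proof.
  intros Hz. unfold disk in Hz. assert (T := Re_le_Cmod z).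
  unfold Re in *; simpl. lra.
Qed.

Lemma Cexp_eq_1 (z : C) : Cexp z = 1 -> exists k : Z, z = (0, 2 * (IZR k * PI)).
Proof.
  intros H. assert (M := Cmod_Cexp z). rewrite H, Cmod_1 in M.
  assert (X : Re z = 0).
  { rewrite <- exp_0 in M. now apply exp_inv in M. }
  assert (Y : cos (Im z) = 1).
  { apply (f_equal Re) in H. unfold Cexp, Re in H; cbn [fst RtoC] in H.
    unfold Re in X. rewrite X, exp_0 in H. unfold RtoC in H. cbn [fst] in H. lra. }
  assert (S : sin (Im z / 2) = 0).
  { replace (Im z) with (2 * (Im z / 2)) in Y by field. rewrite cos_2a_sin in Y. nra. }
  apply sin_eq_0_0 in S. destruct S as [k Hk]. exists k.
  destruct z as [x y]. unfold Re, Im in *; cbn [fst snd] in *. subst x. f_equal. lra.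
Qed.

Section Koebe.
Variable c : R.
Hypothesis Hc : 0 < c <= 2.

Let b (n : nat) : C := RtoC (bcoef c n).
Let S := psum b.
Let S' := psum (dcoef b).
Let E (z : C) : C := Cpower (1 - z) (RtoC c).
Let k (z : C) : C := (z / E z)%C.

(** For c <= 2 the coefficients are dominated by those of (1 - z)^(-2), which are n + 1. *)
Lemma bcoef_bound (n : nat) : 0 <= bcoef c n <= INR n + 1.
Proof.
  induction n as [|n IH]; [simpl; lra|].
  cbn [bcoef]. assert (P := pos_INR n).
  rewrite S_INR.
  split.
  - apply Rmult_le_pos; [apply Rmult_le_pos; lra|]. left. apply Rinv_0_lt_compat. lra.
  - apply Rle_div_l; [lra|]. nra.
Qed.

Lemma tempered_bcoef : tempered b.
Proof.
  assert (A : tempered (fun _ => 1%C)).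
  { intros rho Hrho. exists 1. intros n. rewrite Cmod_1, Rmult_1_l.
    rewrite <- (pow1 n). apply pow_incr. lra. }
  intros rho Hrho. destruct (tempered_mult_index _ A rho Hrho) as [M HM].
  exists M. intros n. eapply Rle_trans; [|apply HM].
  apply Rmult_le_compat_r; [apply pow_le; lra|].
  assert (B := bcoef_bound n). assert (P := pos_INR n). unfold b.
  rewrite Nat.add_1_r, S_INR, Cmult_1_r, !Cmod_R, !Rabs_right; lra.
Qed.

Lemma psum_bcoef_0 : S 0 = 1.
Proof.
  assert (A := psum_incr_1 b 0 tempered_bcoef disk_0).
  apply Cis_series_0 in A.
  - fold S in A. replace (S 0) with (S 0 - b 0%nat + b 0%nat)%C by ring. rewrite A.
    unfold b; cbn [bcoef]. ring.
  - intros n. rewrite Nat.add_1_r. simpl. ring.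
Qed.

(** The recursion (n + 1) b_(n+1) = (c + n) b_n, summed against z^n, says S' = c S + z S'. *)
Lemma psum_bcoef_ode (z : C) : disk z -> ((1 - z) * S' z = RtoC c * S z)%C.
Proof.
  intros Hz.
  assert (A := is_series_psum _ z tempered_bcoef Hz).
  assert (B := is_series_psum _ z (tempered_dcoef _ tempered_bcoef) Hz).
  apply (is_series_scal (K := C_AbsRing) (V := C_NormedModule) z) in B.
  assert (D : Cis_series (fun n => RtoC (INR n) * b n * z ^ n)%C (z * S' z)%C).
  { apply (is_series_decr_1 (K := C_AbsRing) (V := C_NormedModule)).
    refine (eq_rect _ (fun l => Cis_series _ l) _ _ _).
    - eapply is_series_ext; [|exact B]. intros n.
      change (z * (RtoC (INR (n + 1)) * b (n + 1)%nat * z ^ n) =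
        RtoC (INR (Datatypes.S n)) * b (Datatypes.S n) * (z * z ^ n))%C.
      rewrite Nat.add_1_r. ring.
    - change (z * S' z = z * S' z + - (RtoC 0 * b 0%nat * 1))%C. ring. }
  apply (is_series_scal (K := C_AbsRing) (V := C_NormedModule) (RtoC c)) in A.
  assert (F := is_series_plus _ _ _ _ A D).
  assert (G : S' z = (RtoC c * S z + z * S' z)%C).
  { apply (psum_unique (dcoef b)). eapply is_series_ext; [|exact F]. intros n.
    change (RtoC c * (b n * z ^ n) + RtoC (INR n) * b n * z ^ n =
      RtoC (INR (n + 1)) * b (n + 1)%nat * z ^ n)%C.
    rewrite Nat.add_1_r. unfold b; cbn [bcoef].
    rewrite <- (RtoC_mult (INR (Datatypes.S n))).
    replace (INR (Datatypes.S n) * (bcoef c n * (c + INR n) / INR (Datatypes.S n)))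
      with (c * bcoef c n + INR n * bcoef c n) by (field; apply not_0_INR; lia).
    rewrite RtoC_plus, !RtoC_mult. ring. }
  replace ((1 - z) * S' z)%C with (S' z - z * S' z)%C by ring. rewrite G at 1. ring.
Qed.

Lemma cderiv_koebe_den (z : C) : disk z -> cderiv E z (- (RtoC c * E z / (1 - z)))%C.
Proof.
  intros Hz. assert (R1 := Re_one_minus z Hz).
  assert (N := neq_0_of_Re _ R1).
  assert (A := cderiv_comp Cln (fun w => 1 - w)%C _ _ _ (cderiv_Cln _ R1) (cderiv_one_minus z)).
  assert (B := cderiv_mult (fun _ => RtoC c) (fun w => Cln (1 - w)) _ _ _ (cderiv_const (RtoC c) z) A).
  assert (D := cderiv_comp Cexp (fun w => RtoC c * Cln (1 - w))%C _ _ _ (cderiv_Cexp _) B).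
  unfold E, Cpower.
  match type of D with cderiv _ _ ?l =>
    replace (- (RtoC c * Cexp (RtoC c * Cln (1 - z)) / (1 - z)))%C with l by (field; exact N)
  end. exact D.
Qed.

Lemma koebe_den_neq_0 (z : C) : E z <> 0.
Proof. apply Cexp_neq_0. Qed.

(** The equations S' = c S / (1 - z) and E' = - c E / (1 - z) make S E constant along the segment
    from 0 to z; its value at 0 is 1. *)
Lemma binomial_series (z : C) : disk z -> (S z * E z = 1)%C.
Proof.
  intros Hz.
  assert (M := mean_value_Cmod (fun s => S (0 + RtoC s * z) * E (0 + RtoC s * z))%C
    (fun _ => RtoC 0) (fun _ => 0) (fun _ => 0)).
  cbn beta in M.
  replace (0 + RtoC 1 * z)%C with z in M by ring.
  replace (0 + RtoC 0 * z)%C with (RtoC 0) in M by ring.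
  assert (E0 : E 0 = 1).
  { unfold E, Cpower. replace (1 - 0)%C with (RtoC 1) by ring.
    rewrite Cln_1, Cmult_0_r. apply Cexp_0. }
  rewrite psum_bcoef_0, E0 in M.
  assert (Z : (S z * E z - 1 * 1 = 0)%C).
  { apply Cmod_eq_0, Rle_antisym; [|apply Cmod_ge_0].
    rewrite Rminus_0_r in M. apply M.
    intros s Hs. split; [|split; [apply (is_derive_const (V := R_NormedModule))|rewrite Cmod_0; lra]].
    assert (D : disk (0 + RtoC s * z)%C).
    { unfold disk in *. rewrite Cplus_0_l, Cmod_mult, Cmod_R, Rabs_right by lra.
      assert (T := Cmod_ge_0 z). nra. }
    assert (N := neq_0_of_Re _ (Re_one_minus _ D)).
    assert (A := cderiv_mult S E _ _ _ (cderiv_psum b _ tempered_bcoef D) (cderiv_koebe_den _ D)).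
    assert (B := rderiv_comp (fun w => S w * E w)%C (fun s => 0 + RtoC s * z)%C s _ _ A
      (rderiv_line 0 z s)).
    set (w := (0 + RtoC s * z)%C) in *.
    match type of B with rderiv _ _ ?l => replace l with (RtoC 0) in B end; [exact B|].
    transitivity (((1 - w) * S' w - RtoC c * S w) * (E w * z) / (1 - w))%C.
    - rewrite psum_bcoef_ode by exact D. field. exact N.
    - unfold S'. field. exact N. }
  replace (S z * E z)%C with (S z * E z - 1 * 1 + 1)%C by ring. rewrite Z. ring.
Qed.

Lemma koebe_psum (z : C) : disk z -> k z = (z * S z)%C.
Proof.
  intros Hz. unfold k. assert (H := koebe_den_neq_0 z).
  transitivity (z * (S z * E z) / E z)%C; [rewrite binomial_series by exact Hz|]; field; exact H.
Qed.

Lemma psum_bcoef_neq_0 (z : C) : disk z -> S z <> 0.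
Proof.
  intros Hz H. assert (B := binomial_series z Hz). rewrite H, Cmult_0_l in B.
  apply RtoC_inj in B. lra.
Qed.

Lemma cderiv_koebe (z : C) : disk z -> cderiv k z (S z + z * S' z)%C.
Proof.
  intros Hz. apply (cderiv_ext_disk (fun z => z * S z)%C); [exact Hz | |].
  - intros w Hw. symmetry. now apply koebe_psum.
  - replace (S z + z * S' z)%C with (1 * S z + z * S' z)%C by ring.
    apply (cderiv_mult (fun z => z)); [apply cderiv_id|].
    apply cderiv_psum; [apply tempered_bcoef | exact Hz].
Qed.

(** From k = z S: z k' / k = 1 + z S' / S = 1 + c z / (1 - z). *)
Lemma zlogder_koebe (z : C) : disk z -> zlogder k z = ((1 + RtoC (c - 1) * z) / (1 - z))%C.
Proof.
  intros Hz. assert (N := neq_0_of_Re _ (Re_one_minus _ Hz)).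
  unfold zlogder. destruct (Ceq_dec z 0) as [Z|Z].
  - subst z. field; exact N.
  - rewrite (C_derive_cderiv _ _ _ (cderiv_koebe z Hz)), koebe_psum by exact Hz.
    assert (SN := psum_bcoef_neq_0 z Hz).
    assert (Q : S' z = (RtoC c * S z / (1 - z))%C).
    { rewrite <- psum_bcoef_ode by exact Hz. field. exact N. }
    rewrite Q, RtoC_minus. field. now split.
Qed.

Lemma classA_koebe : classA k.
Proof.
  split; [exact (analytic_of_cderiv _ _ cderiv_koebe)|].
  (* The coefficient of z^n in z S is b_(n-1). Only indices n + 2 are read, so the subtraction is
     never truncated. *)
  exists (fun n => b (n - 1)%nat). intros z Hz.
  assert (A := psum_incr_1 b z tempered_bcoef Hz).
  apply (is_series_scal (K := C_AbsRing) (V := C_NormedModule) z) in A.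
  refine (eq_rect _ (fun l => Cis_series _ l) _ _ _).
  - eapply is_series_ext; [|exact A]. intros n.
    change (z * (b (n + 1)%nat * z ^ (n + 1)) = b (n + 2 - 1)%nat * z ^ (n + 2))%C.
    replace (n + 2 - 1)%nat with (n + 1)%nat by lia.
    replace (n + 2)%nat with (Datatypes.S (n + 1)) by lia. rewrite Cpow_S. ring.
  - change (z * (S z - b 0%nat) = k z - z)%C. rewrite koebe_psum by exact Hz.
    unfold b; cbn [bcoef]. ring.
Qed.

(** A logarithm of [k] in the coordinate zeta = log z. The punctured disk lifts to the left half
    plane, which is convex, and Phi' is z k' / k. *)
Let Phi (zeta : C) : C := (zeta - RtoC c * Cln (1 - Cexp zeta))%C.

Lemma disk_Cexp (zeta : C) : Re zeta < 0 -> disk (Cexp zeta).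
Proof. intros H. unfold disk. rewrite Cmod_Cexp, <- exp_0. now apply exp_increasing. Qed.

Lemma Cexp_Phi (zeta : C) : Cexp (Phi zeta) = k (Cexp zeta).
Proof.
  unfold Phi, k, E, Cpower.
  change (zeta - RtoC c * Cln (1 - Cexp zeta))%C with (zeta + - (RtoC c * Cln (1 - Cexp zeta)))%C.
  rewrite Cexp_plus, Cexp_opp. reflexivity.
Qed.

Lemma cderiv_Phi (zeta : C) : Re zeta < 0 ->
  cderiv Phi zeta (1 + RtoC c * (/ (1 - Cexp zeta) - 1))%C.
Proof.
  intros H. assert (D := disk_Cexp _ H). assert (R1 := Re_one_minus _ D).
  assert (N := neq_0_of_Re _ R1).
  assert (A := cderiv_comp (fun w => 1 - w)%C Cexp _ _ _ (cderiv_one_minus _) (cderiv_Cexp zeta)).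
  assert (B := cderiv_comp Cln (fun w => 1 - Cexp w)%C _ _ _ (cderiv_Cln _ R1) A).
  assert (F := cderiv_plus (fun w => w) (fun w => - RtoC c * Cln (1 - Cexp w))%C _ _ _ (cderiv_id zeta)
    (cderiv_mult (fun _ => - RtoC c)%C (fun w => Cln (1 - Cexp w)) _ _ _
      (cderiv_const (- RtoC c)%C zeta) B)).
  apply (cderiv_ext (fun w => w + - RtoC c * Cln (1 - Cexp w))%C); [intros; unfold Phi; ring|].
  match type of F with cderiv _ _ ?l =>
    replace (1 + RtoC c * (/ (1 - Cexp zeta) - 1))%C with l by (field; exact N)
  end. exact F.
Qed.

(** Noshiro-Warschawski: [Re Phi' > 0] on the (convex) left half plane. *)
Lemma Phi_injective (zeta1 zeta2 : C) : Re zeta1 < 0 -> Re zeta2 < 0 ->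
  Phi zeta1 = Phi zeta2 -> zeta1 = zeta2.
Proof.
  intros H1 H2 HE. destruct (Ceq_dec (zeta2 - zeta1)%C 0) as [Z|Z].
  - replace zeta2 with (zeta2 - zeta1 + zeta1)%C by ring. rewrite Z. ring.
  - exfalso. set (d := (zeta2 - zeta1)%C) in *.
    set (line := fun s : R => (zeta1 + RtoC s * d)%C).
    set (dPhi := fun s : R => (1 + RtoC c * (/ (1 - Cexp (line s)) - 1))%C).
    assert (Hl : forall s, 0 <= s <= 1 -> Re (line s) < 0).
    { intros s Hs. unfold line, d. destruct zeta1 as [x1 y1], zeta2 as [x2 y2].
      unfold Re in *; simpl in *.
      replace (x1 + (s * (x2 + - x1) - 0 * (y2 + - y1))) with ((1 - s) * x1 + s * x2) by ring. nra. }
    assert (Hd : forall s, 0 <= s <= 1 -> is_derive (fun s => Re (Cconj d * Phi (line s))%C) s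
      (Re (Cconj d * (dPhi s * d)))%C).
    { intros s Hs.
      assert (A := rderiv_comp Phi line s _ _ (cderiv_Phi _ (Hl s Hs)) (rderiv_line zeta1 d s)).
      apply (rderiv_mult_const_l (Cconj d)) in A. apply A. }
    destruct (MVT_cor2 (fun s => Re (Cconj d * Phi (line s))%C)
      (fun s => Re (Cconj d * (dPhi s * d))%C) 0 1) as [s [Hs Hs01]]; [lra| |].
    { intros s Hs. apply is_derive_Reals. now apply Hd. }
    unfold line in Hs at 1 2.
    replace (zeta1 + RtoC 1 * d)%C with zeta2 in Hs by (unfold d; ring).
    replace (zeta1 + RtoC 0 * d)%C with zeta1 in Hs by ring.
    rewrite HE in Hs.
    replace (Re (Cconj d * (dPhi s * d))%C) with (Cmod d ^ 2 * Re (dPhi s)) in Hs.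
    2:{ rewrite Cmod2_alt. unfold Re, Im; simpl. ring. }
    (* From Re q > 1/2 and c <= 2: 1 + c (Re q - 1) > 1 - c / 2 >= 0. *)
    assert (P : 0 < Re (dPhi s)).
    { assert (I := Re_inv_1_minus _ (disk_Cexp _ (Hl s ltac:(lra)))).
      unfold dPhi. set (q := (/ (1 - Cexp (line s)))%C) in *.
      replace (Re (1 + RtoC c * (q - 1))%C) with (1 + c * (Re q - 1)) by (unfold Re; simpl; ring).
      nra. }
    assert (Q : 0 < Cmod d) by now apply Cmod_gt_0.
    assert (0 < Cmod d ^ 2 * Re (dPhi s)); [|lra].
    apply Rmult_lt_0_compat; [apply pow_lt|]; assumption.
Qed.

(** Equal values of [k] give values of [Phi] differing by a multiple [T] of 2 pi i. Since Phi (w +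
    T) = Phi w + T, shifting one logarithm by [T] makes them equal, and injectivity of [Phi]
    applies. The point 0 has no logarithm and is treated apart. *)
Lemma univalent_koebe : univalent k.
Proof.
  assert (k0 : forall z, k z = 0 -> z = 0).
  { intros z H. unfold k in H. assert (N := koebe_den_neq_0 z).
    replace z with (z / E z * E z)%C by (field; exact N). rewrite H. ring. }
  intros z1 z2 D1 D2 H.
  destruct (Ceq_dec z1 0) as [Z1|Z1].
  { rewrite Z1. symmetry. apply k0. rewrite <- H, Z1. unfold k. field. apply koebe_den_neq_0. }
  destruct (Ceq_dec z2 0) as [Z2|Z2].
  { rewrite Z2. apply k0. rewrite H, Z2. unfold k. field. apply koebe_den_neq_0. }
  assert (ReLn : forall z, disk z -> z <> 0 -> Re (Cln z) < 0).
  { intros z Hz Hn. unfold Cln, Re; cbn [fst]. rewrite <- ln_1.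
    apply ln_increasing; [now apply Cmod_gt_0 | exact Hz]. }
  set (w1 := Cln z1). set (w2 := Cln z2).
  assert (X1 : Cexp w1 = z1) by now apply Cexp_Cln.
  assert (X2 : Cexp w2 = z2) by now apply Cexp_Cln.
  assert (Q : Cexp (Phi w1 - Phi w2) = 1).
  { change (Phi w1 - Phi w2)%C with (Phi w1 + - Phi w2)%C.
    rewrite Cexp_plus, Cexp_opp, !Cexp_Phi, X1, X2, H.
    apply Cinv_r. intros K. now apply Z2, k0. }
  destruct (Cexp_eq_1 _ Q) as [m Hm].
  set (T := (0, 2 * (IZR m * PI)) : C) in *.
  assert (XT : Cexp (w2 + T) = z2).
  { rewrite Cexp_plus, X2.
    replace (Cexp T) with (Cexp (Phi w1 - Phi w2)) by now rewrite Hm.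
    rewrite Q. ring. }
  assert (PT : Phi (w2 + T) = Phi w1).
  { unfold Phi at 1. rewrite XT, <- X2.
    transitivity (Phi w2 + T)%C; [unfold Phi; ring|]. rewrite <- Hm. ring. }
  rewrite <- X1, <- XT. f_equal. apply Phi_injective.
  - now apply ReLn.
  - assert (L := ReLn z2 D2 Z2). fold w2 in L. unfold T, Re in *; simpl in *. lra.
  - now symmetry.
Qed.

End Koebe.

Lemma starlike_order_k (alpha : R) : 0 <= alpha < 1 -> starlike_order alpha (k_ alpha).
Proof.
  intros Ha. assert (Hc : 0 < 2 * (1 - alpha) <= 2) by lra.
  split; [split|].
  - exact (classA_koebe _ Hc).
  - exact (univalent_koebe _ Hc).
  - exists (fun z => z). repeat split; auto.
    + exact (analytic_of_cderiv _ _ (fun z _ => cderiv_id z)).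
    + intros z Hz. replace (1 - 2 * alpha) with (2 * (1 - alpha) - 1) by ring.
      exact (zlogder_koebe _ Hc z Hz).
Qed.

(** * The radius *)

(** [F] is e^(-x) times the Taylor polynomial of degree 7, so that its derivative collapses to -
    e^(-x) x^7 / 7!. The bounds are tight enough for the four decimals of the numerical value. *)
Lemma exp_1_bounds : 2.7155 < exp 1 < 2.7195.
Proof.
  set (F := fun x => exp (- x) * (1 + x + x ^ 2 / 2 + x ^ 3 / 6 + x ^ 4 / 24 + x ^ 5 / 120 +
    x ^ 6 / 720 + x ^ 7 / 5040)).
  destruct (MVT_cor2 F (fun x => - exp (- x) * (x ^ 7 / 5040)) 0 1) as [x [Hx Hx01]]; [lra| |].
  - intros x _. apply is_derive_Reals. unfold F. auto_derive; [trivial|]. field.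
  - unfold F in Hx. rewrite Ropp_0, exp_0, (exp_Ropp 1) in Hx.
    assert (P : 0 < exp (- x) < 1).
    { split; [apply exp_pos|]. rewrite <- exp_0. apply exp_increasing. lra. }
    assert (Q : 0 < x ^ 7 <= 1).
    { split; [apply pow_lt; lra|]. rewrite <- (pow1 7). apply pow_incr. lra. }
    assert (E := exp_pos 1). set (e := exp 1) in *.
    assert (R1 : 0 < exp (- x) * x ^ 7 < 1) by nra.
    assert (S : / e * (1 + 1 + 1 / 2 + 1 / 6 + 1 / 24 + 1 / 120 + 1 / 720 + 1 / 5040) =
      1 - exp (- x) * x ^ 7 / 5040) by lra.
    assert (S2 : 1 + 1 + 1 / 2 + 1 / 6 + 1 / 24 + 1 / 120 + 1 / 720 + 1 / 5040 =
      e * (1 - exp (- x) * x ^ 7 / 5040)) by (rewrite <- S; field; lra).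
    set (y := exp (- x) * x ^ 7) in *. nra.
Qed.

(** * Dilations *)

Lemma classA_0 (f : C -> C) : classA f -> f 0 = 0.
Proof.
  intros H. destruct (classA_psum f H) as [b [_ Hf]]. rewrite Hf by apply disk_0. ring.
Qed.

Section Dilation.
Variables (f : C -> C) (r : R).
Hypothesis Hr : 0 < r <= 1.
Hypothesis Hf : classS f.

Lemma disk_scale (z : C) : disk z -> disk (RtoC r * z).
Proof.
  unfold disk. intros Hz. rewrite Cmod_mult, Cmod_R, Rabs_right by lra.
  assert (P := Cmod_ge_0 z). nra.
Qed.

Lemma RtoC_neq_0 (x : R) : x <> 0 -> RtoC x <> 0.
Proof. intros H E. now apply RtoC_inj in E. Qed.

Lemma cderiv_scale (g : C -> C) (z l : C) : cderiv g (RtoC r * z) l ->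
  cderiv (fun w => g (RtoC r * w))%C z (RtoC r * l)%C.
Proof.
  intros H.
  assert (L := cderiv_mult (fun _ => RtoC r) (fun w => w) z _ _ (cderiv_const _ _) (cderiv_id _)).
  cbn beta in L. replace (0 * z + RtoC r * 1)%C with (RtoC r) in L by ring.
  exact (cderiv_comp g (fun w => RtoC r * w)%C z l (RtoC r) H L).
Qed.

Lemma cderiv_dilation (z l : C) : cderiv f (RtoC r * z) l -> cderiv (dilation r f) z l.
Proof.
  intros H. assert (N := RtoC_neq_0 r ltac:(lra)).
  assert (A := cderiv_mult _ (fun _ => / RtoC r)%C z _ _ (cderiv_scale f z l H) (cderiv_const _ _)).
  cbn beta in A.
  replace (RtoC r * l * / RtoC r + f (RtoC r * z) * 0)%C with l in A by (field; exact N).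
  exact A.
Qed.

Lemma zlogder_dilation (z : C) : disk z -> zlogder (dilation r f) z = zlogder f (RtoC r * z).
Proof.
  intros Hz. assert (N := RtoC_neq_0 r ltac:(lra)).
  unfold zlogder. destruct (Ceq_dec z 0) as [Z|Z], (Ceq_dec (RtoC r * z) 0) as [W|W].
  - reflexivity.
  - exfalso. apply W. rewrite Z. ring.
  - exfalso. revert W. now apply Cmult_neq_0.
  - destruct Hf as [[An Se] U]. destruct (An _ (disk_scale z Hz)) as [l Hl].
    rewrite (C_derive_cderiv _ _ _ Hl), (C_derive_cderiv _ _ _ (cderiv_dilation z l Hl)).
    unfold dilation. field. repeat split; try assumption.
    intros E. apply W, U; [now apply disk_scale | apply disk_0|].
    rewrite E. symmetry. apply classA_0. now split.
Qed.

Lemma classS_dilation : classS (dilation r f).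
Proof.
  assert (N := RtoC_neq_0 r ltac:(lra)).
  destruct Hf as [[An [a Ha]] U]. split; [split|].
  - intros z Hz. destruct (An _ (disk_scale z Hz)) as [l Hl].
    exists l. now apply cderiv_dilation.
  - exists (fun n => a n * RtoC r ^ (n - 1))%C. intros z Hz.
    assert (A := Ha _ (disk_scale z Hz)).
    apply (is_series_scal (K := C_AbsRing) (V := C_NormedModule) (/ RtoC r)%C) in A.
    refine (eq_rect _ (fun l => Cis_series _ l) _ _ _).
    + eapply is_series_ext; [|exact A]. intros n.
      change (/ RtoC r * (a (n + 2)%nat * (RtoC r * z) ^ (n + 2)) =
        a (n + 2)%nat * RtoC r ^ (n + 2 - 1) * z ^ (n + 2))%C.
      replace (n + 2 - 1)%nat with (n + 1)%nat by lia.
      rewrite Cpow_mult_l. replace (n + 2)%nat with (S (n + 1)) at 2 by lia.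
      rewrite (Cpow_S (RtoC r)). field. exact N.
    + change (/ RtoC r * (f (RtoC r * z) - RtoC r * z) = dilation r f z - z)%C.
      unfold dilation. field. exact N.
  - intros z1 z2 D1 D2 E. unfold dilation in E.
    assert (E2 : f (RtoC r * z1) = f (RtoC r * z2)).
    { transitivity (f (RtoC r * z1) / RtoC r * RtoC r)%C; [field; exact N|].
      rewrite E. field. exact N. }
    apply U in E2; try now apply disk_scale.
    transitivity (RtoC r * z1 / RtoC r)%C; [field; exact N|]. rewrite E2. field. exact N.
Qed.

End Dilation.

(** [rA / rT] is [frakB 1]. *)
Definition rA : R := sqrt 2 * exp 1.
Definition rT : R := sqrt (1 + exp 1 ^ 2).

Lemma rA_rT : 0 < rT < rA /\ rT * rT = 1 + exp 1 ^ 2 /\ rA * rA = 2 * exp 1 ^ 2.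
Proof.
  assert (E := exp_1_bounds). unfold rA, rT.
  assert (S2 := sqrt_sqrt 2 ltac:(lra)).
  assert (ST := sqrt_sqrt (1 + exp 1 ^ 2) ltac:(nra)).
  assert (P : 0 < sqrt (1 + exp 1 ^ 2)) by (apply sqrt_lt_R0; nra).
  assert (P2 : 0 < sqrt 2) by (apply sqrt_lt_R0; lra).
  set (e := exp 1) in *. set (q := sqrt 2) in *. set (T := sqrt _) in *.
  assert (A2 : q * e * (q * e) = 2 * e ^ 2) by (replace (q * e * (q * e)) with (q * q * e ^ 2) by ring; rewrite S2; ring).
  repeat split; try assumption.
  apply Rsqr_incrst_0; unfold Rsqr; nra.
Qed.

Definition delta : R := rA / rT - 1.

Lemma delta_pos : 0 < delta.
Proof.
  destruct rA_rT as [[H1 H2] _]. unfold delta.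
  assert (1 < rA / rT); [apply Rlt_div_r|]; lra.
Qed.

(** The left side is 2 - (1 + delta)^2, and rA^2 = 2 rT^2 - 2. *)
Lemma delta_den : 1 - 2 * delta - delta * delta = 2 / (rT * rT).
Proof.
  destruct rA_rT as [[H1 H2] [H3 H4]].
  transitivity (2 - rA * rA / (rT * rT)); [unfold delta; field; lra|].
  replace (rA * rA) with (2 * (rT * rT) - 2) by lra. field. lra.
Qed.

Lemma delta_lt : 2 * delta + delta * delta < 1.
Proof.
  assert (D := delta_den). destruct rA_rT as [[H1 _] _].
  assert (0 < 2 / (rT * rT)); [apply Rdiv_lt_0_compat; nra | lra].
Qed.

(** This is [Blog delta] = 1: the identity (1 + delta)^2 = e^2 (1 - 2 delta - delta^2) after taking
    logarithms. *)
Lemma delta_log : ln (1 + delta) - ln (1 - 2 * delta - delta * delta) / 2 = 1.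
Proof.
  assert (P := delta_pos). assert (D := delta_den).
  destruct rA_rT as [[H1 H2] [H3 H4]].
  assert (Q : 0 < 1 - 2 * delta - delta * delta) by (assert (L := delta_lt); lra).
  assert (E := exp_pos 1).
  assert (K : (1 + delta) * (1 + delta) = (exp 1 * exp 1) * (1 - 2 * delta - delta * delta)).
  { rewrite D. replace (exp 1 * exp 1) with (rA * rA / 2) by (rewrite H4; field).
    unfold delta. field. lra. }
  apply (f_equal ln) in K.
  rewrite !ln_mult, ln_exp in K by (try apply Rmult_lt_0_compat; lra). lra.
Qed.

Lemma Blog_profile_lt (x : R) : 0 <= x < delta ->
  ln (1 + x) - ln (1 - 2 * x - x * x) / 2 < 1.
Proof.
  intros Hx. assert (D := delta_lt). assert (L := delta_log).
  assert (ln (1 + x) < ln (1 + delta)) by (apply ln_increasing; lra).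
  assert (ln (1 - 2 * delta - delta * delta) < ln (1 - 2 * x - x * x)); [|lra].
  apply ln_increasing; nra.
Qed.

(** The solution of (1 + (1 - 2 alpha) x) / (1 - x) = rA / rT, by cross-multiplication. *)
Definition radius (alpha : R) : R := (rA - rT) / ((1 - 2 * alpha) * rT + rA).

Section Radius.
Variable alpha : R.
Hypothesis Ha : 0 <= alpha < 1.

Lemma radius_den_pos : 0 < (1 - 2 * alpha) * rT + rA.
Proof. destruct rA_rT as [[H1 H2] _]. nra. Qed.

Lemma radius_bounds : 0 < radius alpha <= 1.
Proof.
  destruct rA_rT as [[H1 H2] _]. assert (D := radius_den_pos). unfold radius. split.
  - apply Rdiv_lt_0_compat; lra.
  - apply Rle_div_l; [exact D|]. nra.
Qed.

(** The quotient is (1 + (1 - 2 alpha) x) / (1 - x) - 1, which stays below rA / rT - 1 up to the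
    root [radius alpha]. *)
Lemma radius_mobius (x : R) : 0 <= x < radius alpha ->
  x < 1 /\ 2 * (1 - alpha) * x / (1 - x) < delta.
Proof.
  intros Hx. assert (B := radius_bounds). assert (D := radius_den_pos).
  destruct rA_rT as [[H1 H2] _].
  split; [lra|]. apply Rlt_div_l; [lra|].
  destruct Hx as [Hx0 Hx]. unfold radius in Hx. apply Rlt_div_r in Hx; [|exact D].
  apply Rmult_lt_reg_r with rT; [exact H1|].
  replace (delta * (1 - x) * rT) with ((rA - rT) * (1 - x)) by (unfold delta; field; lra).
  lra.
Qed.

Lemma SB_dilation (f : C -> C) (r : R) :
  starlike_order alpha f -> 0 < r <= radius alpha -> SB (dilation r f).
Proof.
  intros Hs Hr. assert (B := radius_bounds). assert (Hr1 : 0 < r <= 1) by lra.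
  assert (Hf := proj1 Hs).
  split; [now apply classS_dilation|].
  destruct (starlike_order_schwarz alpha f ltac:(lra) Hs) as [w [W1 [W2 [W3 W4]]]].
  set (cc := RtoC (2 * (1 - alpha))).
  (* [t z] is z f' / f - 1 at the point r z, written through w, so [Blog (t z)] is the Schwarz
     function sought. *)
  set (t := fun z => (cc * w (RtoC r * z) / (1 - w (RtoC r * z)))%C).
  assert (Hw : forall z, disk z -> Cmod (w (RtoC r * z)%C) < radius alpha).
  { intros z Hz. eapply Rle_lt_trans; [apply W3, disk_scale; assumption|].
    unfold disk in Hz. rewrite Cmod_mult, Cmod_R, Rabs_right by lra.
    assert (P := Cmod_ge_0 z). nra. }
  assert (Hn : forall z, disk z -> 0 < 1 - Cmod (w (RtoC r * z)%C) <= Cmod (1 - w (RtoC r * z))%C).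
  { intros z Hz. assert (L := Hw z Hz).
    assert (L2 := Cmod_sub_le 1 (w (RtoC r * z)%C)). rewrite Cmod_1 in L2. lra. }
  assert (Hn0 : forall z, disk z -> (1 - w (RtoC r * z))%C <> 0).
  { intros z Hz. apply Cmod_gt_0. assert (L := Hn z Hz). lra. }
  assert (Ht : forall z, disk z -> Cmod (t z) < delta).
  { intros z Hz. assert (L := Hn z Hz).
    destruct (radius_mobius _ (conj (Cmod_ge_0 _) (Hw z Hz))) as [_ L2].
    eapply Rle_lt_trans; [|exact L2].
    unfold t. rewrite Cmod_div by now apply Hn0.
    rewrite Cmod_mult. unfold cc. rewrite Cmod_R, Rabs_right by lra.
    apply Rmult_le_compat_l.
    - apply Rmult_le_pos; [lra | apply Cmod_ge_0].
    - apply Rinv_le_contravar; lra. }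
  assert (Dp := delta_pos). assert (Dl := delta_lt).
  exists (fun z => Blog (t z)). repeat split.
  - intros z Hz.
    destruct (W1 _ (disk_scale r Hr1 z Hz)) as [l Hl].
    assert (A := cderiv_scale r w z l Hl).
    assert (A1 := cderiv_mult (fun _ => cc) (fun z => w (RtoC r * z)%C) z _ _ (cderiv_const cc z) A).
    assert (A2 := cderiv_comp (fun u => 1 - u)%C (fun z => w (RtoC r * z)%C) z _ _ (cderiv_one_minus _) A).
    assert (A3 := cderiv_div _ _ z _ _ A1 A2 (Hn0 z Hz)).
    eexists. refine (cderiv_comp Blog t z _ _ _ A3).
    apply (cderiv_Blog delta); auto. left. now apply Ht.
  - intros z Hz. unfold disk.
    eapply Rle_lt_trans; [apply (Cmod_Blog_le delta); auto; left; now apply Ht|].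
    apply Blog_profile_lt. split; [apply Cmod_ge_0 | now apply Ht].
  - unfold t. rewrite Cmult_0_r, W2.
    replace (cc * 0 / (1 - 0))%C with (RtoC 0); [apply Blog_0|].
    unfold Cdiv. ring.
  - intros z Hz. rewrite (frakB_Blog delta); auto; [|left; now apply Ht].
    rewrite zlogder_dilation, W4 by (try apply disk_scale; assumption).
    unfold t, cc. rewrite RtoC_mult, !RtoC_minus, RtoC_mult. field. now apply Hn0.
Qed.

Lemma SB_dilation_k_sharp (rho : R) :
  rho <= 1 -> SB (dilation rho (k_ alpha)) -> rho <= radius alpha.
Proof.
  intros Hrho [_ [w [W1 [W2 [W3 W4]]]]].
  destruct (Rle_dec rho (radius alpha)) as [|Hgt]; [assumption|exfalso].
  apply Rnot_le_lt in Hgt.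
  assert (B := radius_bounds). assert (D := radius_den_pos).
  destruct rA_rT as [[H1 H2] [H3 H4]].
  assert (He := exp_pos 1).
  set (beta := 1 - 2 * alpha) in *.
  set (q2 := sqrt 2). assert (Q2 : q2 * q2 = 2) by (apply sqrt_sqrt; lra).
  assert (Q2p : 0 < q2) by (apply sqrt_lt_R0; lra).
  assert (Q21 : 1 < q2) by nra.
  assert (AT : rA < q2 * rT).
  { apply Rsqr_incrst_0; unfold Rsqr; nra. }
  assert (Hb : -1 < beta <= 1) by (unfold beta; lra).
  (* [rho2] solves (1 + beta x) / (1 - x) = sqrt 2. Staying below it ensures q^2 < 2; it exceeds the
     radius because rA / rT < sqrt 2. *)
  set (rho2 := (q2 - 1) / (q2 + beta)).
  assert (R2 : radius alpha < rho2).
  { unfold radius, rho2. fold beta.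
    apply Rlt_div_l; [exact D|].
    replace ((q2 - 1) / (q2 + beta) * (beta * rT + rA)) with
      ((q2 - 1) * (beta * rT + rA) / (q2 + beta)) by (field; lra).
    apply Rlt_div_r; [lra|]. nra. }
  assert (R2' : rho2 < 1) by (apply Rlt_div_l; lra).
  (* A point beyond the radius, below [rho2], and below [rho] so that x / rho lies in the disk. *)
  set (x := (radius alpha + Rmin rho rho2) / 2).
  assert (M1 := Rmin_l rho rho2). assert (M2 := Rmin_r rho rho2).
  assert (M3 : radius alpha < Rmin rho rho2) by now apply Rmin_glb_lt.
  assert (Hx : radius alpha < x < rho /\ x < rho2) by (unfold x; lra).
  set (q := (1 + beta * x) / (1 - x)).
  assert (Hq1 : rA < q * rT).
  { unfold q. replace ((1 + beta * x) / (1 - x) * rT) with ((1 + beta * x) * rT / (1 - x)) by (field; lra).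
    apply (proj1 (Rlt_div_r rA ((1 + beta * x) * rT) (1 - x) ltac:(lra))).
    destruct Hx as [[Hx _] _]. unfold radius in Hx. fold beta in Hx.
    apply (proj1 (Rlt_div_l _ _ _ D)) in Hx. lra. }
  assert (Hq2 : q < q2).
  { unfold q. apply Rlt_div_l; [lra|].
    destruct Hx as [_ Hx]. unfold rho2 in Hx. apply Rlt_div_r in Hx; lra. }
  assert (Hq : 1 < q) by nra.
  set (z := RtoC (x / rho)).
  assert (Hz : disk z).
  { unfold disk, z. rewrite Cmod_R, Rabs_right.
    - apply Rlt_div_l; lra.
    - apply Rle_ge. apply Rmult_le_pos; [lra|]. left. apply Rinv_0_lt_compat; lra. }
  assert (Hrho' : 0 < rho <= 1) by lra.
  assert (Hx1 : (RtoC rho * z)%C = RtoC x).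
  { unfold z. rewrite <- RtoC_mult. f_equal. field. lra. }
  assert (SK := starlike_order_k alpha Ha).
  assert (E := W4 z Hz).
  rewrite zlogder_dilation in E by (try assumption; apply SK).
  rewrite Hx1 in E. unfold k_ in E.
  rewrite (zlogder_koebe (2 * (1 - alpha)) ltac:(lra)) in E.
  2:{ rewrite <- Hx1. now apply disk_scale. }
  replace ((1 + RtoC (2 * (1 - alpha) - 1) * RtoC x) / (1 - RtoC x))%C with (RtoC q) in E.
  2:{ unfold q, beta. rewrite RtoC_div by lra. rewrite RtoC_plus, RtoC_minus, RtoC_mult.
      do 2 f_equal. f_equal. f_equal. ring. }
  assert (Hw := W2 z Hz). set (v := w z) in *. unfold frakB in E.
  set (V := (1 + Ctanh v)%C) in *.
  assert (HV : V <> 0).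
  { intros K. rewrite K in E. unfold Csqrt in E. rewrite Cmod_0, sqrt_0, Cmult_0_l in E.
    apply RtoC_inj in E. lra. }
  assert (S := Csqrt_sqr V HV). rewrite <- E, <- RtoC_mult in S.
  assert (Hqq : rA * rA < q * q * (rT * rT)) by nra.
  (* At a pole of tanh the quotient takes the default value 0, because [Cinv] of 0 is 0. Then q^2 =
     1, against q > 1. *)
  destruct (Ceq_dec (Cexp v * Cexp v + 1)%C 0) as [Z|Z].
  - assert (C0 : Ctanh v = 0).
    { unfold Ctanh. rewrite Cexp_opp. assert (N := Cexp_neq_0 v).
      replace (Cexp v + / Cexp v)%C with ((Cexp v * Cexp v + 1) / Cexp v)%C by (field; exact N).
      rewrite Z. unfold Cdiv. rewrite Cmult_0_l.
      apply injective_projections; unfold Cmult, Cinv, RtoC; cbn [fst snd]; unfold Rdiv; ring. }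
    unfold V in S. rewrite C0, Cplus_0_r in S. apply RtoC_inj in S. nra.
  - unfold V in S. rewrite one_plus_Ctanh in S by exact Z.
    set (e2 := (Cexp v * Cexp v)%C) in *.
    (* Solves 2 e2 / (e2 + 1) = q^2 for e2 = e^(2v). *)
    assert (K : (RtoC (2 - q * q) * e2 = RtoC (q * q))%C).
    { rewrite RtoC_minus.
      transitivity (RtoC 2 * e2 / (e2 + 1) * (e2 + 1) - RtoC (q * q) * e2)%C; [field; exact Z|].
      rewrite <- S. ring. }
    assert (Hqlt : q * q < 2) by nra.
    (* In moduli, (2 - q^2) e^(2 Re v) = q^2. As Re v < 1 this gives q^2 (1 + e^2) < 2 e^2, whereas
       rA < q rT states the opposite. *)
    apply (f_equal Cmod) in K. unfold e2 in K.
    rewrite !Cmod_mult, !Cmod_R, !Rabs_right, Cmod_Cexp in K by nra.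
    assert (L : exp (Re v) < exp 1).
    { apply exp_increasing. eapply Rle_lt_trans; [apply Re_le_Cmod | exact Hw]. }
    assert (L0 := exp_pos (Re v)).
    assert (L2 : exp (Re v) * exp (Re v) < exp 1 ^ 2) by nra.
    rewrite H3, H4 in Hqq.
    assert (L3 : (2 - q * q) * (exp (Re v) * exp (Re v)) < (2 - q * q) * exp 1 ^ 2)
      by (apply Rmult_lt_compat_l; lra).
    lra.
Qed.

(** The positive half is inherited by subclasses and the sharp half only tests [k_ alpha], so the
    whole class and the single function [k_ alpha] have the same radius. *)
Lemma is_radius_between (G : (C -> C) -> Prop) :
  G (k_ alpha) -> (forall f, G f -> starlike_order alpha f) -> is_radius SB G (radius alpha).
Proof.
  intros Hk HG. split; [split; [exact radius_bounds|]|].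
  - intros f Hf r Hr. apply SB_dilation; auto.
  - intros rho [H1 H2]. apply SB_dilation_k_sharp; [lra|]. apply H2; [exact Hk | lra].
Qed.

End Radius.

Lemma radius_0_approx : Rabs (radius 0 - 1406 / 10000) < 5 / 100000.
Proof.
  assert (E := exp_1_bounds). destruct rA_rT as [[H1 H2] [H3 H4]].
  set (e := exp 1) in *.
  unfold radius. replace ((1 - 2 * 0) * rT + rA) with (rA + rT) by ring.
  (* 0.14055 < (rA - rT) / (rA + rT) cross-multiplied, with coefficients 1 + 0.14055 and 1 -
     0.14055. Squaring removes the roots; [U] treats 0.14065 likewise. *)
  assert (L : 1.14055 * rT < 0.85945 * rA).
  { apply Rsqr_incrst_0; unfold Rsqr; try nra. }
  assert (U : 0.85935 * rA < 1.14065 * rT).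
  { apply Rsqr_incrst_0; unfold Rsqr; try nra. }
  apply Rabs_def1.
  - assert ((rA - rT) / (rA + rT) < 0.14065); [|lra].
    apply (proj2 (Rlt_div_l _ _ (rA + rT) ltac:(lra))). lra.
  - assert (0.14055 < (rA - rT) / (rA + rT)); [|lra].
    apply (proj1 (Rlt_div_r _ _ (rA + rT) ltac:(lra))). lra.
Qed.

Theorem corollary4p2 :
  (forall alpha : R, 0 <= alpha < 1 ->
    let rho := (sqrt 2 * exp 1 - sqrt (1 + exp 1 ^ 2)) /
               ((1 - 2 * alpha) * sqrt (1 + exp 1 ^ 2) + sqrt 2 * exp 1) in
    is_radius SB (starlike_order alpha) rho /\
    starlike_order alpha (k_ alpha) /\
    is_radius SB (fun f : C -> C => f = k_ alpha) rho) /\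
  (let rho0 := (sqrt 2 * exp 1 - sqrt (1 + exp 1 ^ 2)) /
               (sqrt 2 * exp 1 + sqrt (1 + exp 1 ^ 2)) in
    is_radius SB starlike rho0 /\
    Rabs (rho0 - 1406 / 10000) < 5 / 100000).
Proof.
  split.
  - intros alpha Ha. change (let rho := radius alpha in
      is_radius SB (starlike_order alpha) rho /\
      starlike_order alpha (k_ alpha) /\
      is_radius SB (fun f : C -> C => f = k_ alpha) rho). intros rho.
    assert (K := starlike_order_k alpha Ha).
    split; [|split]; [| exact K |]; apply is_radius_between; auto.
    intros f Hf. now rewrite Hf.
  - intros rho0. replace rho0 with (radius 0).
    + split; [|exact radius_0_approx].
      apply is_radius_between; [lra | apply starlike_order_k; lra | auto].
    + unfold radius, rho0, rA, rT. f_equal. ring.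
Qed.
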